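(* Let $R$ be a Noetherian commutative ring and $S$ a finitely generated commutative $R$-algebra such that the induced map of spectra $\mathrm{Spec}\,S\to\mathrm{Spec}\,R$ is surjective. Let $F$ be a flat $R$-module. Then $F$ is a very flat $R$-module if and only if the $S$-module $S\otimes_RF$ is very flat.
   Context: For a commutative ring $A$ and $a\in A$, $A[a^{-1}]$ is the localization at the powers of $a$. An $A$-module $C$ is contraadjusted if $\mathrm{Ext}^1_A(A[a^{-1}],C)=0$ for every $a\in A$; an $A$-module $F$ is very flat if $\mathrm{Ext}^1_A(F,C)=0$ for every contraadjusted $A$-module $C$. *)

(* Defs.v *)
From HB Require Import structures.
From mathcomp Require Import all_boot all_order all_algebra.
Set Implicit Arguments. Unset Strict Implicit. Unset Printing Implicit Defensive.
Import GRing.Theory.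
Local Open Scope ring_scope.

Definition Lin (A : pzRingType) (M N : lmodType A) (f : M -> N) : Prop :=
  forall (r : A) (x y : M), f (r *: x + y) = r *: f x + f y.

Definition Ext1_vanishes (A : comPzRingType) (L C : lmodType A) : Prop :=
  forall (E : lmodType A) (f : C -> E) (g : E -> L),
    Lin f -> Lin g -> injective f -> (forall l, exists e, g e = l) ->
    (forall e, g e = 0 <-> exists c, f c = e) ->
    exists s : L -> E, Lin s /\ forall l, g (s l) = l.

Definition IsLocalizationAt (A : comPzRingType) (a : A) (L : lmodType A)
    (iota : A -> L) : Prop :=
  [/\ (forall (r x y : A), iota (r * x + y) = r *: iota x + iota y),
      injective (fun l : L => a *: l),
      (forall l : L, exists l' : L, a *: l' = l),
      (forall l : L, exists (r : A) (n : nat), a ^+ n *: l = iota r) &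
      (forall r : A, iota r = 0 <-> exists n : nat, a ^+ n * r = 0)].

Definition contraadjusted (A : comPzRingType) (C : lmodType A) : Prop :=
  forall (a : A) (L : lmodType A) (iota : A -> L),
    IsLocalizationAt a iota -> Ext1_vanishes L C.

Definition very_flat (A : comPzRingType) (F : lmodType A) : Prop :=
  forall C : lmodType A, contraadjusted C -> Ext1_vanishes F C.

Definition Bilin (A : comPzRingType) (M N P : lmodType A) (b : M -> N -> P) : Prop :=
  (forall n, Lin (fun m => b m n)) /\ (forall m, Lin (b m)).

Definition IsTensor (A : comPzRingType) (M N T : lmodType A) (b : M -> N -> T) : Prop :=
  Bilin b /\
  forall (P : lmodType A) (h : M -> N -> P), Bilin h ->
    exists phi : T -> P, [/\ Lin phi, (forall m n, phi (b m n) = h m n) &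
      forall psi : T -> P, Lin psi -> (forall m n, psi (b m n) = h m n) ->
        forall t, psi t = phi t].

Definition flat (A : comPzRingType) (F : lmodType A) : Prop :=
  forall (M M' : lmodType A) (f : M -> M'), Lin f -> injective f ->
  forall (T : lmodType A) (b : M -> F -> T) (T' : lmodType A) (b' : M' -> F -> T'),
    IsTensor b -> IsTensor b' ->
    forall phi : T -> T', Lin phi -> (forall m x, phi (b m x) = b' (f m) x) ->
      injective phi.

Definition is_ideal (A : comPzRingType) (I : A -> Prop) : Prop :=
  [/\ I 0, (forall x y, I x -> I y -> I (x + y)) & (forall r x, I x -> I (r * x))].

Definition is_prime_ideal (A : comPzRingType) (I : A -> Prop) : Prop :=
  [/\ is_ideal I, ~ I 1 & (forall x y, I (x * y) -> I x \/ I y)].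

Definition noetherian (A : comPzRingType) : Prop :=
  forall I : A -> Prop, is_ideal I ->
    exists gens : seq A, forall x, I x <->
      exists c : seq A, size c = size gens /\
        x = \sum_(i < size gens) c`_i * gens`_i.

Definition fin_gen_algebra (R S : comPzRingType) (phi : {rmorphism R -> S}) : Prop :=
  exists gens : seq S, forall x : S,
    forall P : S -> Prop,
      (forall r, P (phi r)) -> (forall g, g \in gens -> P g) ->
      (forall u v, P u -> P v -> P (u + v)) ->
      (forall u v, P u -> P v -> P (u * v)) -> P x.

Definition spec_surjective (R S : comPzRingType) (phi : {rmorphism R -> S}) : Prop :=
  forall p : R -> Prop, is_prime_ideal p ->
    exists q : S -> Prop, is_prime_ideal q /\ forall r, p r <-> q (phi r).

(* (T, j) is the base change S (x)_R F as an S-module, via the universal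
   property Hom_S(S (x)_R F, P) = Hom_R(F, P): j : F -> T is R-linear
   (T viewed as R-module through phi) and universal among such maps. *)
Definition RLin (R S : comPzRingType) (phi : {rmorphism R -> S})
    (F : lmodType R) (P : lmodType S) (h : F -> P) : Prop :=
  forall (r : R) (x y : F), h (r *: x + y) = phi r *: h x + h y.

Definition IsBaseChange (R S : comPzRingType) (phi : {rmorphism R -> S})
    (F : lmodType R) (T : lmodType S) (j : F -> T) : Prop :=
  RLin phi j /\
  forall (P : lmodType S) (h : F -> P), RLin phi h ->
    exists g : T -> P, [/\ Lin g, (forall x, g (j x) = h x) &
      forall g' : T -> P, Lin g' -> (forall x, g' (j x) = h x) ->
        forall t, g' t = g t].

(* Main.v *)
(* Contraadjustedness of C is solvability of the systems x_n = c_n + a x_(n+1), so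
   every module embeds in a contraadjusted one (its reduced power over nat) and very
   flat modules are closed under syzygies. Let F be flat with S (x) F very flat; this
   passes to syzygies of F, so Ext^1(F, -) = 0 may be checked on contraadjusted C by
   devissage: noetherian induction on an annihilator I of C reduces to I = p prime,
   where C has a resolution by two contraadjusted R/p-torsion-free modules P. For c
   outside p put J = cap c^n P; then P/J is c-adically complete with P/cP covered by
   induction, and J is a module over (R/p)[1/c]. By Zariski's lemma some prime of S
   over p has, for suitable c, a residue algebra D with D[1/c] finite free over
   (R/p)[1/c]. Then X = Hom(D[1/c], J) is an S-module with J as an R-direct summand,
   and Ext^1_R(F, X) = Ext^1_S(S (x) F, X) = 0 as soon as X is contraadjusted over S.
   The latter is a statement about systems x_n = e_n + M x_(n+1) with M a matrix over
   R, and follows from the same devissage and the Cayley-Hamilton theorem. *)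
Require Import Defs.
From HB Require Import structures.
From mathcomp Require Import all_boot all_order all_algebra.
From mathcomp Require Import boolp functions.
From mathcomp Require Import ring_quotient ring.
Set Implicit Arguments. Unset Strict Implicit. Unset Printing Implicit Defensive.
Import GRing.Theory.
Local Open Scope ring_scope.

(** * Linear maps, quotients and free modules *)

(** In the descent direction the hypothesis controls only Ext^1 from F into modules with an
    S-structure, and a contraadjusted R-module has none; the devissage serves to reach, over each
    prime p, modules J that are R-summands of S-modules. The prime q of S over p is taken maximal
    among the ideals contracting to p, so that inverting the nonzero elements of R/p turns S/q into
    a field, which is the setting of Zariski's lemma. Passing from the torsion-free resolution K ->
    P -> C to C would cost Ext^2(F, K); this is Ext^1(-, K) of a syzygy of F, hence the induction
    treats all admissible F at once. Completeness of P/J enters through equations: a contraadjusted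
    module solves y_n = x_n + c y_(n+1), which sums the series of the c^n x_n, and separatedness
    makes the sum unique. Matrix systems appear because an element of S acts on X = J^(n+1) by a
    matrix over R up to a power of c, so that contraadjustedness of X over S goes beyond scalar
    systems over R. *)

Definition onto (X Y : Type) (f : X -> Y) := forall y, exists x, f x = y.

Section LinTheory.
Context {A : pzRingType} {M N P : lmodType A}.
Implicit Types (f : M -> N) (g : N -> P).

Lemma Lin0 f : Lin f -> f 0 = 0.
Proof.
by move=> fL; move: (fL 1 0 0); rewrite !scale1r addr0 => /eqP;
  rewrite -subr_eq0 opprD addNKr oppr_eq0 => /eqP.
Qed.

Lemma LinZ f : Lin f -> forall r x, f (r *: x) = r *: f x.
Proof. by move=> fL r x; rewrite -[r *: x]addr0 fL Lin0 // addr0. Qed.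

Lemma LinD f : Lin f -> forall x y, f (x + y) = f x + f y.
Proof. by move=> fL x y; rewrite -{1}[x]scale1r fL scale1r. Qed.

Lemma LinN f : Lin f -> forall x, f (- x) = - f x.
Proof. by move=> fL x; rewrite -scaleN1r LinZ // scaleN1r. Qed.

Lemma LinB f : Lin f -> forall x y, f (x - y) = f x - f y.
Proof. by move=> fL x y; rewrite LinD // LinN. Qed.

Lemma Lin_sum f : Lin f -> forall I (s : seq I) (p : pred I) F,
  f (\sum_(i <- s | p i) F i) = \sum_(i <- s | p i) f (F i).
Proof. by move=> fL I s p F; apply: (big_morph f (LinD fL) (Lin0 fL)). Qed.

Lemma Lin_inj f : Lin f -> (forall x, f x = 0 -> x = 0) -> injective f.
Proof.
by move=> fL f0 x y /eqP; rewrite -subr_eq0 -(LinB fL) => /eqP/f0/eqP; rewrite subr_eq0 => /eqP.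
Qed.

Lemma Lin_comp f g : Lin f -> Lin g -> Lin (g \o f).
Proof. by move=> fL gL r x y /=; rewrite fL gL. Qed.

End LinTheory.

Lemma Lin_id (A : pzRingType) (M : lmodType A) : Lin (@id M).
Proof. by []. Qed.

Lemma Lin_sub (A : comPzRingType) (M N : lmodType A) (f g : M -> N) :
  Lin f -> Lin g -> Lin (fun x => f x - g x).
Proof.
by move=> fL gL r x y; rewrite fL gL opprD scalerBr addrACA.
Qed.

(* The underlying type is kept, so that modules over different rings can share their elements. *)
Definition lmod_on (A : pzRingType) (V : zmodType) (sc : A -> V -> V) : Type := V.

Section MkLmod.
Variables (A : pzRingType) (V : zmodType) (sc : A -> V -> V).
Hypotheses (scA : forall a b v, sc a (sc b v) = sc (a * b) v)
  (sc1 : left_id 1 sc) (scDr : right_distributive sc +%R)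
  (scDl : forall v, {morph sc^~ v : a b / a + b}).
HB.instance Definition _ := GRing.Zmodule.on (lmod_on sc).
HB.instance Definition _ :=
  GRing.Zmodule_isLmodule.Build A (lmod_on sc) scA sc1 scDr scDl.
Definition mk_lmod : lmodType A := lmod_on sc.
End MkLmod.

Section Restriction.
Variables (R S : pzRingType) (phi : {rmorphism R -> S}) (X : lmodType S).
Let sc (r : R) (x : X) := phi r *: x.
Fact restr_A a b v : sc a (sc b v) = sc (a * b) v.
Proof. by rewrite /sc scalerA rmorphM. Qed.
Fact restr_1 : left_id 1 sc.
Proof. by move=> v; rewrite /sc rmorph1 scale1r. Qed.
Fact restr_Dr : right_distributive sc +%R.
Proof. by move=> a x y; rewrite /sc scalerDr. Qed.
Fact restr_Dl v : {morph sc^~ v : a b / a + b}.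
Proof. by move=> a b; rewrite /sc rmorphD scalerDl. Qed.
Definition restr : lmodType R := mk_lmod restr_A restr_1 restr_Dr restr_Dl.
End Restriction.

Definition submod (A : pzRingType) (M : lmodType A) (N : M -> Prop) :=
  N 0 /\ forall r x y, N x -> N y -> N (r *: x + y).

Section Submod.
Variables (A : pzRingType) (M : lmodType A) (N : M -> Prop).
Hypothesis sN : submod N.

Lemma submodZ r x : N x -> N (r *: x).
Proof. by case: sN => N0 NL Nx; rewrite -[_ *: _]addr0; apply: NL. Qed.
Lemma submodD x y : N x -> N y -> N (x + y).
Proof. by case: sN => N0 NL Nx Ny; rewrite -[x]scale1r; apply: NL. Qed.
Lemma submodN x : N x -> N (- x).
Proof. by move=> Nx; rewrite -scaleN1r; apply: submodZ. Qed.
Definition sub_of : Type := {x : M | N x}.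
HB.instance Definition _ := gen_eqMixin sub_of.
HB.instance Definition _ := gen_choiceMixin sub_of.
Let mk x (Nx : N x) : sub_of := exist N x Nx.
Let val_inj (u v : sub_of) : sval u = sval v -> u = v.
Proof. by case: u v => [x p] [y q] /=; apply: eq_exist. Qed.

Let w0 : sub_of := mk (proj1 sN).
Let wN (u : sub_of) : sub_of := mk (submodN (svalP u)).
Let wD (u v : sub_of) : sub_of := mk (submodD (svalP u) (svalP v)).
Let wZ r (u : sub_of) : sub_of := mk (submodZ r (svalP u)).
Let wA : associative wD. Proof. by move=> *; apply: val_inj; apply: addrA. Qed.
Let wC : commutative wD. Proof. by move=> *; apply: val_inj; apply: addrC. Qed.
Let w0D : left_id w0 wD. Proof. by move=> *; apply: val_inj; apply: add0r. Qed.
Let wND : left_inverse w0 wN wD. Proof. by move=> *; apply: val_inj; apply: addNr. Qed.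
HB.instance Definition _ := GRing.isZmodule.Build sub_of wA wC w0D wND.
Let wZA a b v : wZ a (wZ b v) = wZ (a * b) v.
Proof. by apply: val_inj; apply: scalerA. Qed.
Let wZ1 : left_id 1 wZ. Proof. by move=> *; apply: val_inj; apply: scale1r. Qed.
Let wZDr : right_distributive wZ +%R.
Proof. by move=> *; apply: val_inj; apply: scalerDr. Qed.
Let wZDl v : {morph wZ^~ v : a b / a + b}.
Proof. by move=> *; apply: val_inj; apply: scalerDl. Qed.

Lemma sub_lmod : exists (K : lmodType A) (i : K -> M),
  [/\ Lin i, injective i & forall x, N x <-> exists k, i k = x].
Proof.
exists (mk_lmod wZA wZ1 wZDr wZDl), sval; split => //.
move=> x; split; first by move=> Nx; exists (mk Nx).
by case=> k <-; apply: svalP.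
Qed.

End Submod.

Section Quotient.
Variables (A : pzRingType) (M : lmodType A) (N : M -> Prop).
Hypothesis sN : submod N.

Let cls (x y : M) := N (x - y).
Let clsE x y : N (x - y) -> cls x = cls y.
Proof.
move=> Nxy; apply/funext => z; apply/propext; rewrite /cls; split=> H.
  by rewrite -(subrKA x) -opprB; apply: (submodD sN) H; apply: (submodN sN).
by rewrite -(subrKA y); apply: (submodD sN) H.
Qed.
(** A coset is its own membership predicate, so extensionality turns congruence into equality; [rep]
    picks representatives by choice. *)
Definition quot_of : Type := {P : M -> Prop | exists x, P = cls x}.
HB.instance Definition _ := gen_eqMixin quot_of.
HB.instance Definition _ := gen_choiceMixin quot_of.
Let mk x : quot_of := exist _ (cls x) (ex_intro _ x erefl).
Let rep (u : quot_of) : M := sval (cid (svalP u)).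
Let repK u : mk (rep u) = u.
Proof.
rewrite /rep; case: cid => x /=; case: u => [P p] /= e; exact/eq_exist/esym.
Qed.
Let mkE x y : mk x = mk y <-> N (x - y).
Proof.
split=> [[] e|H]; last by apply/eq_exist/clsE.
have : cls y y by rewrite /cls subrr; case: sN.
by rewrite -e.
Qed.
Let mk_rep x : N (rep (mk x) - x). Proof. by apply/mkE; rewrite repK. Qed.

Let w0 : quot_of := mk 0.
Let wN (u : quot_of) : quot_of := mk (- rep u).
Let wD (u v : quot_of) : quot_of := mk (rep u + rep v).
Let wZ r (u : quot_of) : quot_of := mk (r *: rep u).
Let mkD x y : wD (mk x) (mk y) = mk (x + y).
Proof. by apply/mkE; rewrite opprD addrACA; apply: (submodD sN); apply: mk_rep. Qed.
Let mkN x : wN (mk x) = mk (- x).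
Proof. by apply/mkE; rewrite -opprD; apply: (submodN sN); apply: mk_rep. Qed.
Let mkZ r x : wZ r (mk x) = mk (r *: x).
Proof. by apply/mkE; rewrite -scalerBr; apply: (submodZ sN); apply: mk_rep. Qed.

Let wA : associative wD.
Proof. by move=> u v w; rewrite -[u]repK -[v]repK -[w]repK !mkD addrA. Qed.
Let wC : commutative wD.
Proof. by move=> u v; rewrite -[u]repK -[v]repK !mkD addrC. Qed.
Let w0D : left_id w0 wD.
Proof. by move=> u; rewrite -[u]repK mkD add0r. Qed.
Let wND : left_inverse w0 wN wD.
Proof. by move=> u; rewrite -[u]repK mkN mkD addNr. Qed.
HB.instance Definition _ := GRing.isZmodule.Build quot_of wA wC w0D wND.
Let wZA a b v : wZ a (wZ b v) = wZ (a * b) v.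
Proof. by rewrite -[v]repK !mkZ scalerA. Qed.
Let wZ1 : left_id 1 wZ. Proof. by move=> v; rewrite -[v]repK mkZ scale1r. Qed.
Let wZDr : right_distributive wZ +%R.
Proof.
move=> a x y; rewrite -[x]repK -[y]repK.
change (wZ a (wD (mk (rep x)) (mk (rep y))) = wD (wZ a (mk (rep x))) (wZ a (mk (rep y)))).
by rewrite mkD !mkZ mkD scalerDr.
Qed.
Let wZDl v : {morph wZ^~ v : a b / a + b}.
Proof.
move=> a b; rewrite -[v]repK.
change (wZ (a + b) (mk (rep v)) = wD (wZ a (mk (rep v))) (wZ b (mk (rep v)))).
by rewrite !mkZ mkD scalerDl.
Qed.

Lemma quot_lmod : exists (Q : lmodType A) (p : M -> Q),
  [/\ Lin p, onto p & forall x, p x = 0 <-> N x].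
Proof.
exists (mk_lmod wZA wZ1 wZDr wZDl), mk; split.
- by move=> r x y; rewrite -mkD -mkZ.
- by move=> u; exists (rep u).
- by move=> x; rewrite (_ : 0 = mk 0) // mkE subr0.
Qed.

End Quotient.

Section FactorLift.
Context {A : pzRingType}.

Lemma factor_surj (M Q P : lmodType A) (p : M -> Q) (h : M -> P) :
  Lin p -> onto p -> Lin h -> (forall x, p x = 0 -> h x = 0) ->
  exists h' : Q -> P, Lin h' /\ forall x, h' (p x) = h x.
Proof.
move=> pL pS hL ker_le; have [s sK] := choice pS.
have hE x y : p x = p y -> h x = h y.
  move=> e; apply/eqP; rewrite -subr_eq0 -(LinB hL); apply/eqP/ker_le.
  by rewrite (LinB pL) e subrr.
exists (h \o s); split=> [r x y|x] /=; last by apply: hE; rewrite sK.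
by rewrite -hL; apply: hE; rewrite pL !sK.
Qed.

Lemma lift_through (K M P : lmodType A) (i : K -> M) (h : P -> M) :
  Lin i -> injective i -> Lin h -> (forall x, exists k, i k = h x) ->
  exists h' : P -> K, Lin h' /\ forall x, i (h' x) = h x.
Proof.
move=> iL iI hL /choice[h' h'K]; exists h'; split=> // r x y.
by apply: iI; rewrite iL !h'K hL.
Qed.

End FactorLift.

Definition ses (A : pzRingType) (C E L : lmodType A) (f : C -> E) (g : E -> L) :=
  [/\ Lin f, Lin g, injective f, onto g & forall e, g e = 0 <-> exists c, f c = e].

Lemma ses_sub (A : pzRingType) (M : lmodType A) (N : M -> Prop) : submod N ->
  exists (K Q : lmodType A) (i : K -> M) (p : M -> Q),
    ses i p /\ forall x, p x = 0 <-> N x.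
Proof.
move=> sN; have [K [i [iL iI iN]]] := sub_lmod sN.
have [Q [p [pL pS pN]]] := quot_lmod sN.
exists K, Q, i, p; split=> //; split=> // e.
by rewrite pN iN.
Qed.

Lemma ses_ker (A : pzRingType) (M L : lmodType A) (g : M -> L) : Lin g -> onto g ->
  exists (K : lmodType A) (i : K -> M), ses i g.
Proof.
move=> gL gS; have sN : submod (fun x => g x = 0).
  by split=> [|r x y gx gy]; rewrite ?(Lin0 gL) // gL gx gy scaler0 addr0.
by have [K [i [iL iI iN]]] := sub_lmod sN; exists K, i.
Qed.

Lemma ses_img (A : pzRingType) (K M : lmodType A) (i : K -> M) : Lin i -> injective i ->
  exists (Q : lmodType A) (p : M -> Q), ses i p.
Proof.
move=> iL iI; have sN : submod (fun x => exists k, i k = x).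
  split=> [|r x y [k <-] [l <-]]; first by exists 0; rewrite (Lin0 iL).
  by exists (r *: k + l); rewrite iL.
by have [Q [p [pL pS pN]]] := quot_lmod sN; exists Q, p.
Qed.

Lemma ses_comp0 (A : pzRingType) (C E L : lmodType A) (f : C -> E) (g : E -> L) :
  ses f g -> forall c, g (f c) = 0.
Proof. by case=> _ _ _ _ ex c; apply/ex; exists c. Qed.

Section Free.
Variable A : comPzRingType.

Definition eval (M : lmodType A) (I : Type) (u : I -> M) (l : seq (A * I)) : M :=
  \sum_(p <- l) p.1 *: u p.2.

Lemma eval_cat (M : lmodType A) I (u : I -> M) l l' : eval u (l ++ l') = eval u l + eval u l'.
Proof. by rewrite /eval big_cat. Qed.

Lemma eval_nil (M : lmodType A) I (u : I -> M) : eval u [::] = 0.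
Proof. by rewrite /eval big_nil. Qed.

Lemma eval_1 (M : lmodType A) I (u : I -> M) i : eval u [:: (1, i)] = u i.
Proof. by rewrite /eval big_seq1 scale1r. Qed.

Lemma eval_scale (M : lmodType A) I (u : I -> M) r l :
  eval u [seq (r * p.1, p.2) | p <- l] = r *: eval u l.
Proof. by rewrite /eval big_map scaler_sumr; apply: eq_bigr => p _; rewrite scalerA. Qed.

Lemma eval_Lin (M P : lmodType A) I (u : I -> M) (g : M -> P) l : Lin g ->
  g (eval u l) = eval (g \o u) l.
Proof. by move=> gL; rewrite /eval (Lin_sum gL); apply: eq_bigr => p _; rewrite (LinZ gL). Qed.

(** Two expressions of one element differ by a relation, so the value does not depend on the
    expression chosen. This serves modules known by generators and relations, such as a localization
    or a base change. *)
Lemma span_ext (M P : lmodType A) (I : Type) (u : I -> M) (h : I -> P) :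
  (forall m, exists l, eval u l = m) ->
  (forall l, eval u l = 0 -> eval h l = 0) ->
  exists g : M -> P, Lin g /\ forall i, g (u i) = h i.
Proof.
move=> uS u0; have [s sK] := choice uS.
have hE l l' : eval u l = eval u l' -> eval h l = eval h l'.
  move=> e; have := u0 (l ++ [seq (-1 * p.1, p.2) | p <- l']).
  rewrite !eval_cat !eval_scale e !scaleN1r subrr => /(_ erefl)/eqP.
  by rewrite subr_eq0 => /eqP.
exists (fun m => eval h (s m)); split=> [r x y|i].
  by rewrite -eval_scale -eval_cat; apply: hE; rewrite eval_cat eval_scale !sK.
by rewrite -[RHS]eval_1; apply: hE; rewrite sK eval_1.
Qed.

Lemma span_eq (M P : lmodType A) (I : Type) (u : I -> M) (g g' : M -> P) :
  (forall m, exists l, eval u l = m) -> Lin g -> Lin g' ->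
  (forall i, g (u i) = g' (u i)) -> forall m, g m = g' m.
Proof.
move=> uS gL gL' e m; have [l <-] := uS m; rewrite (eval_Lin _ _ gL) (eval_Lin _ _ gL').
by apply: eq_bigr => p _ /=; rewrite e.
Qed.

Lemma submod_span (M : lmodType A) (I : Type) (u : I -> M) :
  submod (fun m => exists l, eval u l = m).
Proof.
split=> [|r _ _ [l <-] [l' <-]]; first by exists [::]; rewrite eval_nil.
by exists ([seq (r * p.1, p.2) | p <- l] ++ l'); rewrite eval_cat eval_scale.
Qed.

(* [co g i] is the coefficient of [g] at the basis vector [u i]. *)
Definition is_free (I : eqType) (G : lmodType A) (u : I -> G) (co : G -> I -> A) :=
  [/\ forall g, exists l, eval u l = g,
      forall r x y i, co (r *: x + y) i = r * co x i + co y i,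
      forall i j, co (u i) j = (i == j)%:R &
      forall g, (forall i, co g i = 0) -> g = 0].

(** Finite support is automatic: [G] is the span of the delta functions inside all functions from
    [I] to [A], and [co] is the inclusion. *)
Lemma free_exists (I : eqType) : exists (G : lmodType A) (u : I -> G) (co : G -> I -> A),
  is_free u co.
Proof.
pose d (i : I) : (I -> A^o : lmodType A) := fun j => (i == j)%:R.
have [G [io [iL iI iN]]] := sub_lmod (submod_span d).
have /choice[u uK] i : exists g, io g = d i.
  by apply/iN; exists [:: (1, i)]; rewrite eval_1.
exists G, u, io; split=> [g|r x y i|i j|g g0].
- have [l lE] : exists l, eval d l = io g by apply/iN; exists g.
  exists l; apply: iI; rewrite (eval_Lin _ _ iL) -lE.
  by apply: eq_bigr => p _ /=; rewrite uK.
- by rewrite iL.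
- by rewrite uK.
- by apply: iI; rewrite (Lin0 iL); apply/funext => i; rewrite g0.
Qed.

Section FreeTheory.
Variables (I : eqType) (G : lmodType A) (u : I -> G) (co : G -> I -> A).
Hypothesis fG : is_free u co.

Lemma co_Lin i : Lin (fun g => co g i : A^o).
Proof. by case: fG => _ coL _ _ r x y; rewrite coL. Qed.

Lemma eval_group (P : lmodType A) (h : I -> P) (l : seq (A * I)) (ys : seq I) :
  uniq ys -> (forall p, p \in l -> p.2 \in ys) ->
  eval h l = \sum_(y <- ys) co (eval u l) y *: h y.
Proof.
move=> Uy ly; case: (fG) => _ _ cou _; rewrite /eval big_seq.
under [RHS]eq_bigr => y _.
  rewrite (Lin_sum (co_Lin y)) scaler_suml big_seq; over.
rewrite exchange_big /=; apply: eq_bigr => p pl.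
rewrite (bigD1_seq p.2) ?ly //= big1 ?addr0.
  by rewrite (LinZ (co_Lin _)) cou eqxx /GRing.scale /= mulr1.
move=> y yp; have -> : co (p.1 *: u p.2) y = p.1 * co (u p.2) y by exact: (LinZ (co_Lin y)).
by rewrite cou eq_sym (negPf yp) mulr0 scale0r.
Qed.

Lemma free_support (s : seq G) : exists ys : seq I, uniq ys /\
  forall g, g \in s -> g = \sum_(y <- ys) co g y *: u y.
Proof.
case: (fG) => uS _ _ _; have [w wK] := choice uS.
pose ys := undup (flatten [seq [seq p.2 | p <- w g] | g <- s]).
exists ys; split=> [|g gs]; first exact: undup_uniq.
rewrite -{1}(wK g) (eval_group u (ys := ys)) ?undup_uniq ?wK // => p pl.
by rewrite mem_undup; apply/flattenP; exists [seq p.2 | p <- w g]; apply: map_f.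
Qed.

Lemma free_ext (P : lmodType A) (h : I -> P) :
  exists g : G -> P, Lin g /\ forall i, g (u i) = h i.
Proof.
case: (fG) => uS _ _ _; apply: span_ext => // l l0.
rewrite (eval_group h (undup_uniq [seq p.2 | p <- l])).
  by rewrite l0 big1 // => y _; rewrite (Lin0 (co_Lin y)) scale0r.
by move=> p pl; rewrite mem_undup map_f.
Qed.

End FreeTheory.

Definition projective (G : lmodType A) :=
  forall (M N : lmodType A) (p : M -> N) (h : G -> N), Lin p -> onto p -> Lin h ->
    exists h' : G -> M, Lin h' /\ forall x, p (h' x) = h x.

Lemma free_projective (I : eqType) (G : lmodType A) (u : I -> G) (co : G -> I -> A) :
  is_free u co -> projective G.
Proof.
move=> fG M N p h pL pS hL; have [s sK] := choice pS.
have [h' [h'L h'E]] := free_ext fG (fun i => s (h (u i))).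
exists h'; split=> //; case: fG => uS _ _ _.
by apply: (span_eq uS _ hL) => [|i /=]; [apply: Lin_comp | rewrite h'E sK].
Qed.

Lemma free_presentation (F : lmodType A) : exists (G K : lmodType A) (u : F -> G)
    (co : G -> F -> A) (k : K -> G) (p : G -> F),
  [/\ is_free u co, ses k p & forall x, p (u x) = x].
Proof.
have [G [u [co fG]]] := free_exists F.
have [p [pL pE]] := free_ext fG (@id F).
have pS : onto p by move=> x; exists (u x).
have [K [k kE]] := ses_ker pL pS.
by exists G, K, u, co, k, p.
Qed.

Lemma projective_presentation (F : lmodType A) : exists (G K : lmodType A)
    (k : K -> G) (p : G -> F), projective G /\ ses k p.
Proof.
have [G [K [u [co [k [p [fG kp _]]]]]]] := free_presentation F.
by exists G, K, k, p; split=> //; apply: free_projective fG.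
Qed.

End Free.

(** * Ext^1 and contraadjusted modules *)

Section Ext.
Variable A : comPzRingType.
Implicit Types (C E L M N K G F P W : lmodType A).

Lemma Lin_pair M N P (f : M -> N) (g : M -> P) : Lin f -> Lin g ->
  Lin (fun x => (f x, g x) : (N * P)%type).
Proof. by move=> fL gL r x y; rewrite fL gL. Qed.

Lemma Lin_0 M N : Lin (fun _ : M => 0 : N).
Proof. by move=> r x y; rewrite scaler0 addr0. Qed.

Lemma Ext1_ses C E L (f : C -> E) (g : E -> L) : Ext1_vanishes L C -> ses f g ->
  exists s : L -> E, Lin s /\ forall l, g (s l) = l.
Proof. by move=> V [fL gL fI gS ex]; apply: (V E f g). Qed.

(** [Q] is C x G modulo the pairs (h x, - k x); injectivity of [k] keeps [f] injective. *)
Lemma pushout C L K G (k : K -> G) (p : G -> L) (h : K -> C) : ses k p -> Lin h ->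
  exists (Q : lmodType A) (f : C -> Q) (g : Q -> L) (j : G -> Q),
    [/\ ses f g, Lin j, forall y, g (j y) = p y & forall x, j (k x) = f (h x)].
Proof.
move=> kp hL; case: (kp) => kL pL kI pS kpE.
pose i (x : K) : (C * G)%type := (h x, - k x).
have iL : Lin i.
  by move=> r x y; congr pair; rewrite /= ?hL ?kL ?opprD ?scalerN.
have iI : injective i by move=> x y /(congr1 snd) /= /oppr_inj/kI.
have [Q [q [_ qL _ qS qE]]] := ses_img iL iI.
have pL2 : Lin (fun x : (C * G)%type => p x.2) by move=> r x y; rewrite pL.
have [|g [gL gE]] := factor_surj qL qS pL2.
  by move=> x /qE[c <-] /=; rewrite (LinN pL) (ses_comp0 kp) oppr0.
pose f (c : C) := q (c, 0).
have fL : Lin f.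
  by move=> r x y; rewrite /f -qL; congr q; congr pair; rewrite /= scaler0 addr0.
exists Q, f, g, (fun y => q (0, y)); split=> [|r x y|y|x].
- split=> //.
  + apply: (Lin_inj fL) => c /qE[x] [<- /eqP].
    by rewrite oppr_eq0 => /eqP kx; rewrite (_ : x = 0) ?(Lin0 hL) //; apply: kI; rewrite (Lin0 kL).
  + by move=> l; have [y <-] := pS l; exists (q (0, y)); rewrite gE.
  + move=> e; split=> [|[c <-]]; last by rewrite gE /= (Lin0 pL).
    have [[c y] <-] := qS e; rewrite gE /= => /kpE[x <-].
    exists (c + h x); apply/eqP; rewrite -subr_eq0 -(LinB qL); apply/eqP/qE.
    by exists x; rewrite /i; congr pair; rewrite /= ?(addrC c) ?addrK ?sub0r.
- by rewrite -qL; congr q; congr pair; rewrite /= scaler0 addr0.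
- by rewrite gE.
- apply/esym/eqP; rewrite -subr_eq0 -(LinB qL); apply/eqP/qE; exists x.
  by rewrite /i; congr pair; rewrite /= ?subr0 ?sub0r.
Qed.

(** Once the pushout along [h] splits, subtracting the split part from [j] leaves a map into C that
    extends [h]. Together with [hom_Ext1] this describes Ext^1 as a cokernel of Hom groups and
    replaces long exact sequences. *)
Lemma Ext1_hom L C K G (k : K -> G) (p : G -> L) (h : K -> C) :
  Ext1_vanishes L C -> ses k p -> Lin h ->
  exists h' : G -> C, Lin h' /\ forall x, h' (k x) = h x.
Proof.
move=> V kp hL; have [Q [f [g [j [fg jL gj jk]]]]] := pushout kp hL.
have [s [sL sK]] := Ext1_ses V fg; case: (kp) => _ pL _ _ _; case: (fg) => fL gL fI _ fgE.
have [|h' [h'L h'E]] := lift_through fL fI (Lin_sub jL (Lin_comp pL sL)).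
  by move=> y; apply/fgE; rewrite (LinB gL) /= sK gj subrr.
exists h'; split=> // x.
by apply: fI; rewrite h'E /= (ses_comp0 kp) (Lin0 sL) subr0.
Qed.

Lemma hom_Ext1 L C K G (k : K -> G) (p : G -> L) : projective G -> ses k p ->
  (forall h : K -> C, Lin h -> exists h' : G -> C, Lin h' /\ forall x, h' (k x) = h x) ->
  Ext1_vanishes L C.
Proof.
move=> Gp kp H E f g fL gL fI gS fgE; case: (kp) => kL pL kI pS kpE.
have [e [eL eE]] := Gp _ _ g p gL gS pL.
have [|h [hL hE]] := lift_through fL fI (Lin_comp kL eL).
  by move=> x; apply/fgE; rewrite /= eE (ses_comp0 kp).
have [h' [h'L h'E]] := H h hL.
have [|s [sL sE]] := factor_surj pL pS (Lin_sub eL (Lin_comp h'L fL)).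
  by move=> y /kpE[x <-] /=; rewrite h'E hE /= subrr.
exists s; split=> // l; have [y <-] := pS l.
have fg0 c : g (f c) = 0 by apply/fgE; exists c.
by rewrite sE /= (LinB gL) eE fg0 subr0.
Qed.

(** The extension is pulled back along [h] to the fibre product [W] inside E x L; a section of [W]
    over L is a lift of [h]. *)
Lemma Ext1_lift L C E P (f : C -> E) (g : E -> P) (h : L -> P) :
  Ext1_vanishes L C -> ses f g -> Lin h ->
  exists h' : L -> E, Lin h' /\ forall x, g (h' x) = h x.
Proof.
move=> V fg hL; case: (fg) => fL gL fI gS fgE.
have sN : submod (fun x : (E * L)%type => g x.1 = h x.2).
  split=> [|r x y ex ey] /=; first by rewrite (Lin0 gL) (Lin0 hL).
  by rewrite gL hL ex ey.
have [W [i [iL iI iE]]] := sub_lmod sN.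
have fW c : exists w, i w = (f c, 0).
  by apply/iE; rewrite /= (ses_comp0 fg) (Lin0 hL).
have fWL : Lin (fun c => (f c, 0) : (E * L)%type) by apply: Lin_pair => //; apply: Lin_0.
have [f' [f'L f'E]] := lift_through iL iI fWL fW.
have g'L : Lin (fun w => (i w).2) by move=> r x y; rewrite iL.
have f'I : injective f' by move=> x y e; apply: fI; move: (f'E x) (f'E y); rewrite e => -> [].
have g'S : onto (fun w => (i w).2).
  move=> l; have [e eE] := gS (h l).
  by have [|w wE] := (proj1 (iE (e, l))); [rewrite /= eE | exists w; rewrite wE].
have ex w : (i w).2 = 0 <-> exists c, f' c = w.
  split=> [w0|[c <-]]; last by rewrite f'E.
  have : g (i w).1 = 0 by rewrite (proj2 (iE (i w))) ?w0 ?(Lin0 hL) //; exists w.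
  move=> /fgE[c cE]; exists c; apply: iI; rewrite f'E cE -w0; by case: (i w).
have [s [sL sK]] := V W f' _ f'L g'L f'I g'S ex.
exists (fun l => (i (s l)).1); split=> [r x y|l]; first by rewrite sL iL.
by rewrite (proj2 (iE (i (s l)))) ?sK //; exists (s l).
Qed.

Lemma Ext1_extension F C E P (f : C -> E) (g : E -> P) : ses f g ->
  Ext1_vanishes F C -> Ext1_vanishes F P -> Ext1_vanishes F E.
Proof.
move=> fg VC VP; case: (fg) => fL gL fI gS fgE.
have [G [K [k [p [Gp kp]]]]] := projective_presentation F.
apply: (hom_Ext1 Gp kp) => h hL; case: (kp) => kL pL _ _ _.
have [h1 [h1L h1E]] := Ext1_hom VP kp (Lin_comp hL gL).
have [h2 [h2L h2E]] := Gp _ _ g h1 gL gS h1L.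
have [|d [dL dE]] := lift_through fL fI (Lin_sub hL (Lin_comp kL h2L)).
  by move=> x; apply/fgE; rewrite (LinB gL) /= h2E h1E /= subrr.
have [d' [d'L d'E]] := Ext1_hom VC kp dL.
exists (fun y => h2 y + f (d' y)); split=> [r x y|x].
  by rewrite h2L d'L fL scalerDr addrACA.
by rewrite d'E dE /= addrC subrK.
Qed.

(** This is exactness of Ext^1(F, P) -> Ext^1(F, C) -> Ext^2(F, K), with Ext^1(W, K) for the syzygy
    W in place of Ext^2(F, K). *)
Lemma Ext1_quotient F G W K P C (k : W -> G) (p : G -> F) (f : K -> P) (g : P -> C) :
  projective G -> ses k p -> ses f g ->
  Ext1_vanishes W K -> Ext1_vanishes F P -> Ext1_vanishes F C.
Proof.
move=> Gp kp fg VK VP; apply: (hom_Ext1 Gp kp) => h hL; case: (fg) => fL gL _ _ _.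
have [h1 [h1L h1E]] := Ext1_lift VK fg hL.
have [h2 [h2L h2E]] := Ext1_hom VP kp h1L.
exists (g \o h2); split; first exact: Lin_comp.
by move=> x; rewrite /= h2E h1E.
Qed.

End Ext.

Section Contraadjusted.
Variable A : comPzRingType.
Implicit Types (C E L M N K G F P W : lmodType A).

(* Ext^1(A[1/a], C) = 0 spelled out on the presentation of A[1/a] by generators u_n
   and relations u_n = a u_(n+1). *)
Definition ca C := forall (a : A) (c : nat -> C),
  exists x : nat -> C, forall n, x n = c n + a *: x n.+1.

(** A system in [L] lifts term by term to [E]. The closure under quotients reflects that A[1/a] has
    projective dimension at most one. *)
Lemma ca_quotient E L (g : E -> L) : Lin g -> onto g -> ca E -> ca L.
Proof.
move=> gL gS cE a c; have [s sK] := choice gS.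
have [x xE] := cE a (s \o c); exists (g \o x) => n /=.
by rewrite xE (LinD gL) (LinZ gL) /= sK.
Qed.

Lemma ca_extension C E L (f : C -> E) (g : E -> L) : ses f g -> ca C -> ca L -> ca E.
Proof.
move=> fg cC cL a c; case: (fg) => fL gL fI gS fgE.
have [s sK] := choice gS; have [y yE] := cL a (g \o c).
have /choice[d dE] n : exists d, f d = c n + a *: s (y n.+1) - s (y n).
  by apply/fgE; rewrite (LinB gL) (LinD gL) (LinZ gL) !sK [in X in _ - X]yE subrr.
have [z zE] := cC a d; exists (fun n => s (y n) + f (z n)) => n.
rewrite zE (LinD fL) (LinZ fL) dE scalerDr.
by rewrite addrA [s (y n) + _]addrC subrK addrA.
Qed.

Lemma germs M : exists (Q : lmodType A) (cl : (nat -> M : lmodType A) -> Q),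
  [/\ Lin cl, onto cl &
      forall v, cl v = 0 <-> exists n, forall k, (n <= k)%N -> v k = 0].
Proof.
have sN : submod (fun v : (nat -> M : lmodType A) => exists n, forall k, (n <= k)%N -> v k = 0).
  split; first by exists 0.
  move=> r x y [m mE] [n nE]; exists (maxn m n) => k; rewrite geq_max => /andP[mk nk].
  have -> : (r *: x + y) k = r *: x k + y k by [].
  by rewrite mE // nE // scaler0 addr0.
by have [Q [cl clE]] := quot_lmod sN; exists Q, cl.
Qed.

(** In coordinate k the series x_n = sum of a^(i-n) c_i is cut off at i < k. The recursion then
    holds in every coordinate k > n, which is all that a germ sees. *)
Lemma germ_ca M (Q : lmodType A) (cl : (nat -> M : lmodType A) -> Q) : Lin cl -> onto cl ->
  (forall v, cl v = 0 <-> exists n, forall k, (n <= k)%N -> v k = 0) -> ca Q.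
Proof.
move=> clL clS cl0 a c; have [s sK] := choice clS.
pose x n k := \sum_(n <= i < k) a ^+ (i - n) *: s (c i) k.
exists (fun n => cl (x n)) => n.
apply/eqP; rewrite -subr_eq0 -[c n]sK -(LinZ clL) -(LinD clL) -(LinB clL); apply/eqP/cl0.
exists n.+1 => k nk.
have -> : (x n - (s (c n) + a *: x n.+1)) k = x n k - (s (c n) k + a *: x n.+1 k) by [].
rewrite /x big_ltn // subnn expr0 scale1r scaler_sumr.
rewrite (_ : \sum_(n.+1 <= i < k) _ = \sum_(n.+1 <= i < k) a *: (a ^+ (i - n.+1) *: s (c i) k)).
  by rewrite subrr.
rewrite !big_nat; apply: eq_bigr => i /andP[ni _].
by rewrite scalerA -exprS -subSn.
Qed.

(* The witness is the reduced power of M modulo eventually zero sequences. *)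
Lemma ca_embed M : exists (Q : lmodType A) (d : M -> Q), [/\ Lin d, injective d & ca Q].
Proof.
have [Q [cl [clL clS cl0]]] := germs M.
have dL : Lin (fun x => cl (fun=> x)) by move=> r x y; rewrite -clL.
exists Q, (fun x => cl (fun=> x)); split=> //; last exact: germ_ca cl0.
by apply: (Lin_inj dL) => x /cl0[n /(_ n (leqnn n))].
Qed.

Lemma eval_telescope M (a : A) (v : nat -> M) (l : seq (A * nat)) (m : nat) :
  (forall n, v n = a *: v n.+1) ->
  (forall p, p \in l -> (p.2 <= m)%N) ->
  eval v l = (\sum_(p <- l) p.1 * a ^+ (m - p.2)) *: v m.
Proof.
move=> vE lm; rewrite /eval scaler_suml !big_seq; apply: eq_bigr => p /lm pm.
rewrite -scalerA; congr (_ *: _).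
rewrite -{2}(subnKC pm); elim: (m - _)%N => [|d IH]; first by rewrite expr0 scale1r addn0.
by rewrite exprSr -scalerA addnS -vE.
Qed.

(** Lifts to E of the generators u_n = 1/a^n violate u_n = a u_(n+1) by elements c_n of C; a
    solution of the system for c corrects them to lifts e_n that define a section. *)
Lemma ca_contraadjusted C : ca C -> contraadjusted C.
Proof.
move=> cC a L iota [iotaL aI aS aF iota0] E f g fL gL fI gS fgE.
have [d dK] := choice aS; have [s sK] := choice gS.
pose u n := iter n d (iota 1).
have uE n : u n = a *: u n.+1 by rewrite /u /= dK.
have iotaZ : Lin (iota : A^o -> L) by [].
have anI n : injective (fun l : L => a ^+ n *: l).
  elim: n => [|n IH] x y; rewrite ?expr0 ?scale1r // exprSr -!scalerA.
  by move=> /IH/aI.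
have auE n m : u n = a ^+ m *: u (n + m)%N.
  elim: m => [|m IH]; first by rewrite expr0 scale1r addn0.
  by rewrite exprSr -scalerA addnS -uE.
have u0E n r : a ^+ n *: (r *: u n) = iota r.
  by rewrite scalerA mulrC -scalerA -[n in u n]add0n -auE /u /= -(LinZ iotaZ) /GRing.scale /= mulr1.
have uS l : exists w, eval u w = l.
  have [r [n rn]] := aF l; exists [:: (r, n)]; rewrite /eval big_seq1 /=.
  by apply: (anI n); rewrite u0E rn.
have /choice[c cE] n : exists c, f c = s (u n) - a *: s (u n.+1).
  by apply/fgE; rewrite (LinB gL) (LinZ gL) !sK -uE subrr.
have [x xE] := cC a c.
pose e n := s (u n) - f (x n).
have eE n : e n = a *: e n.+1.
  rewrite /e xE (LinD fL) cE (LinZ fL) scalerBr opprD opprB.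
  by rewrite addrA [s (u n) + _]addrC subrK.
have [t [tL tE]] : exists t : L -> E, Lin t /\ forall n, t (u n) = e n.
  apply: span_ext => // w; pose N := \max_(p <- w) p.2.
  have wN p : p \in w -> (p.2 <= N)%N by move=> pw; rewrite /N; apply: leq_bigmax_seq.
  rewrite (eval_telescope uE wN) (eval_telescope eE wN); set r := \sum_(_ <- _) _.
  (* The relation r u_N = 0 gives only a^m r = 0; this still kills r e_N, because e_N is itself a
     multiple of a^m. *)
  move=> ru; have [m mE] : exists m, a ^+ m * r = 0.
    by apply/iota0; rewrite -(u0E N) ru scaler0.
  have aeE n k : e n = a ^+ k *: e (n + k)%N.
    elim: k => [|k IH]; first by rewrite expr0 scale1r addn0.
    by rewrite exprSr -scalerA addnS -eE.
  by rewrite (aeE N m) scalerA mulrC mE scale0r.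
have fg0 z : g (f z) = 0 by apply/fgE; exists z.
exists t; split=> //; apply: (span_eq uS (Lin_comp tL gL) (@Lin_id _ L)) => n /=.
by rewrite tE /e (LinB gL) fg0 subr0 sK.
Qed.

Section Converse.
Variables (a : A) (C : lmodType A) (c : nat -> C).

(** Germs in [LP] form the colimit of A -> A -> ... along a, that is A[1/a]. Germs in [EP] form the
    colimit of A x C along (r, x) |-> (a r, x + r c_k), an extension of A[1/a] by C that encodes the
    system. *)
Let LP (p : nat -> A) := exists n, forall k, (n <= k)%N -> p k.+1 = a * p k.
Let EP (v : nat -> A^o * C) := exists n, forall k, (n <= k)%N ->
  (v k.+1).1 = a * (v k).1 /\ (v k.+1).2 = (v k).2 + (v k).1 *: c k.

(* L and E consist of germs at infinity: 1/a^n is the germ of k |-> a^(k-n), and it has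
   lifts e_n to E with e_n - a e_(n+1) = c_n. *)
Lemma localization_witness : exists (L E : lmodType A) (iota : A -> L)
  (f : C -> E) (g : E -> L) (u : nat -> L),
  [/\ IsLocalizationAt a iota, ses f g, forall n, u n = a *: u n.+1 &
      forall s : L -> E, Lin s -> (forall l, g (s l) = l) ->
      exists x : nat -> C, forall n, x n = c n + a *: x n.+1].
Proof.
have [Q1 [cl1 [cl1L cl1S cl10]]] := germs A^o.
have [Q2 [cl2 [cl2L cl2S cl20]]] := germs (A^o * C)%type.
have sL : submod (fun x => exists p, cl1 p = x /\ LP p).
  split; first by exists 0; rewrite (Lin0 cl1L); split=> //; exists 0 => k _; rewrite mulr0.
  move=> r _ _ [p [<- [m mE]]] [q [<- [n nE]]].
  exists (r *: p + q); rewrite cl1L; split=> //; exists (maxn m n) => k.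
  rewrite geq_max => /andP[mk nk].
  have E i : (r *: p + q) i = r * p i + q i by [].
  by rewrite !E mE // nE // mulrDr mulrCA.
have sE : submod (fun x => exists v, cl2 v = x /\ EP v).
  split.
    exists 0; rewrite (Lin0 cl2L); split=> //; exists 0 => k _.
    by split=> //=; rewrite ?mulr0 // scale0r addr0.
  move=> r _ _ [p [<- [m mE]]] [q [<- [n nE]]].
  exists (r *: p + q); rewrite cl2L; split=> //; exists (maxn m n) => k.
  rewrite geq_max => /andP[mk nk]; have [p1 p2] := mE _ mk; have [q1 q2] := nE _ nk.
  have E1 i : ((r *: p + q) i).1 = r * (p i).1 + (q i).1 by [].
  have E2 i : ((r *: p + q) i).2 = r *: (p i).2 + (q i).2 by [].
  rewrite !E1 !E2 p1 q1 p2 q2; split; first by rewrite mulrDr mulrCA.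
  by rewrite scalerDr scalerDl scalerA addrACA.
have [L [i [iL iI iE]]] := sub_lmod sL.
have [E [j [jL jI jE]]] := sub_lmod sE.
have eq1 p q : (exists n, forall k, (n <= k)%N -> p k = q k) -> cl1 p = cl1 q.
  move=> [n nE]; apply/eqP; rewrite -subr_eq0 -(LinB cl1L); apply/eqP/cl10.
  by exists n => k nk; rewrite -(subrr (q k)) -{1}(nE k nk).
have eq2 p q : (exists n, forall k, (n <= k)%N -> p k = q k) <-> cl2 p = cl2 q.
  split=> [[n nE]|e].
    apply/eqP; rewrite -subr_eq0 -(LinB cl2L); apply/eqP/cl20.
    by exists n => k nk; rewrite -(subrr (q k)) -{1}(nE k nk).
  have /cl20[n nE] : cl2 (p - q) = 0 by rewrite (LinB cl2L) e subrr.
  by exists n => k /nE/eqP; rewrite subr_eq0 => /eqP.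
have iotaL : Lin (fun r : A^o => cl1 (fun k => r * a ^+ k)).
  move=> r x y; rewrite -cl1L; congr cl1; apply/funext => k.
  have -> : (r *: x + y) * a ^+ k = (r * x + y) * a ^+ k by [].
  by rewrite mulrDl -mulrA.
have [|iota [iota1 iota2]] := lift_through iL iI iotaL.
  by move=> r; apply/iE; exists (fun k => r * a ^+ k); split=> //; exists 0 => k _;
    rewrite exprS mulrCA.
have LE l : exists p, i l = cl1 p /\ LP p.
  by have /iE[p [<- pP]] : exists k, i k = i l by [exists l]; exists p.
have EE e : exists v, j e = cl2 v /\ EP v.
  by have /jE[v [<- vP]] : exists k, j k = j e by [exists e]; exists v.
have pr1L : Lin (fun v : (nat -> A^o * C : lmodType A) => cl1 (fun k => (v k).1)).
  by move=> r x y; rewrite -cl1L.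
have [|pr [prL prE]] := factor_surj cl2L cl2S pr1L.
  by move=> v /cl20[n nE]; apply/cl10; exists n => k nk; rewrite nE.
have [|g [gL gE]] := lift_through iL iI (Lin_comp jL prL).
  move=> e; have [v [ve [n nE]]] := EE e; apply/iE; exists (fun k => (v k).1).
  by rewrite /= ve prE; split=> //; exists n => k /nE[].
have cstL : Lin (fun x : C => cl2 (fun=> (0, x))).
  by move=> r x y; rewrite -cl2L; congr cl2; apply/funext => k; congr pair;
    rewrite /= scaler0 addr0.
have [|f [fL fE]] := lift_through jL jI cstL.
  move=> x; apply/jE; exists (fun=> (0, x)); split=> //; exists 0 => k _.
  by split=> /=; rewrite ?mulr0 // scale0r addr0.
have uL n : exists l, i l = cl1 (fun k => a ^+ (k - n)).
  by apply/iE; eexists; split; [reflexivity | exists n => k nk; rewrite subSn // exprS].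
have {uL} [u uE] := choice uL.
have auE n : u n = a *: u n.+1.
  apply: iI; rewrite (LinZ iL) !uE -(LinZ cl1L); apply: eq1; exists n.+1 => k nk.
  by have -> : (a *: (fun k => a ^+ (k - n.+1) : A^o)) k = a * a ^+ (k - n.+1) by [];
    rewrite -exprS -subSn.
exists L, E, iota, f, g, u; split=> //.
- split.
  + by move=> r x y; apply: (iota1 r x y).
  + apply: (@Lin_inj A L L (fun l => a *: l)).
      by move=> r x y; rewrite scalerDr !scalerA mulrC.
    move=> l; have [p [pE [n nE]]] := LE l; move=> al0; apply: iI; rewrite (Lin0 iL) pE.
    have /cl10[m mE] : cl1 (a *: p) = 0 by rewrite (LinZ cl1L) -pE -(LinZ iL) al0 (Lin0 iL).
    apply/cl10; exists (maxn m n).+1 => -[//|k]; rewrite ltnS geq_max => /andP[mk nk].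
    by rewrite nE //; apply: (mE k mk).
  + move=> l; have [p [pE [n nE]]] := LE l.
    have [l' l'E] : exists l', i l' = cl1 (fun k => p k.-1).
      by apply/iE; eexists; split; [reflexivity | exists n.+1 => -[//|k] nk /=; apply: nE].
    exists l'; apply: iI; rewrite (LinZ iL) l'E -(LinZ cl1L) pE; apply: eq1.
    by exists n.+1 => -[//|k] nk; rewrite nE.
  + move=> l; have [p [pE [n nE]]] := LE l; exists (p n), n; apply: iI.
    rewrite (LinZ iL) pE iota2 -(LinZ cl1L); apply: eq1; exists n => k nk.
    have -> : (a ^+ n *: p) k = a ^+ n * p k by [].
    rewrite -(subnKC nk); elim: (k - n)%N => [|m IH]; first by rewrite addn0 mulrC.
    by rewrite addnS nE ?leq_addr // mulrCA IH exprS mulrCA.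
  + move=> r; split=> [r0|[n nE]].
      have /cl10[n /(_ n (leqnn n))] : cl1 (fun k => r * a ^+ k) = 0 by rewrite -iota2 r0 (Lin0 iL).
      by exists n; rewrite mulrC.
    apply: iI; rewrite (Lin0 iL) iota2; apply/cl10; exists n => k nk.
    by rewrite -(subnKC nk) exprD mulrA (mulrC r) nE mul0r.
- split=> //.
  + apply: (Lin_inj fL) => x fx0; have : cl2 (fun=> (0, x)) = 0 by rewrite -fE fx0 (Lin0 jL).
    by move=> /cl20[n /(_ n (leqnn n))[]].
  + move=> l; have [p [pE [n nE]]] := LE l.
    have [e eE] : exists e, j e = cl2 (fun k => (p k, \sum_(0 <= m < k) p m *: c m)).
      apply/jE; eexists; split; [reflexivity | exists n => k nk /=].
      by rewrite nE // big_nat_recr.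
    by exists e; apply: iI; rewrite gE /= eE prE pE.
  + move=> e; split=> [ge0|[x <-]]; last first.
      by apply: iI; rewrite gE /= fE prE (Lin0 iL); apply/cl10; exists 0.
    have [v [vE [n nE]]] := EE e.
    have /cl10[m mE] : cl1 (fun k => (v k).1) = 0 by rewrite -prE -vE -[pr _]gE ge0 (Lin0 iL).
    exists (v (maxn m n)).2; apply: jI; rewrite fE vE; apply/eq2; exists (maxn m n) => k mnk.
    rewrite -(subnKC mnk); elim: (k - _)%N => [|d IH].
      by rewrite addn0 [in RHS](surjective_pairing (v _)) mE ?leq_maxl.
    have le1 : (m <= maxn m n + d)%N by rewrite (leq_trans (leq_maxl m n)) ?leq_addr.
    have le2 : (n <= maxn m n + d)%N by rewrite (leq_trans (leq_maxr m n)) ?leq_addr.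
    rewrite addnS [in RHS](surjective_pairing (v _)) !(proj1 (nE _ le2)) (proj2 (nE _ le2)) -IH.
    by rewrite /= mulr0 scale0r addr0.
- move=> s sL' sK.
  (* A lift of u_n is determined up to a constant x_n of C. Compatibility of the section with u_n =
     a u_(n+1) becomes the system, up to a sign. *)
  have /choice[x xE] n : exists x, j (s (u n)) =
      cl2 (fun k => (a ^+ (k - n), x + \sum_(n <= m < k) a ^+ (m - n) *: c m)).
    have [v [vE [m mE]]] := EE (s (u n)).
    have /eqP : cl1 (fun k => (v k).1) = cl1 (fun k => a ^+ (k - n)).
      by rewrite -prE -vE -[pr _]gE sK uE.
    rewrite -subr_eq0 -(LinB cl1L) => /eqP/cl10[m' m'E].
    pose N := maxn n (maxn m m').
    have [nN mN m'N] : [/\ n <= N, m <= N & m' <= N]%N by rewrite !leq_max !leqnn !orbT.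
    have v1 k : (N <= k)%N -> (v k).1 = a ^+ (k - n).
      by move=> Nk; apply/eqP; rewrite -subr_eq0; apply/eqP/m'E/(leq_trans m'N).
    exists ((v N).2 - \sum_(n <= i < N) a ^+ (i - n) *: c i); rewrite vE; apply/eq2;
      exists N => k Nk.
    rewrite [LHS]surjective_pairing v1 //; congr pair.
    rewrite -(subnKC Nk); elim: (k - N)%N => [|d IH]; first by rewrite addn0 subrK.
    have le2 : (m <= N + d)%N by rewrite (leq_trans mN) ?leq_addr.
    rewrite addnS (proj2 (mE _ le2)) IH v1 ?leq_addr // big_nat_recr /=;
      last by rewrite (leq_trans nN) ?leq_addr.
    by rewrite addrA.
  exists (fun n => - x n) => n.
  have : j (s (u n)) = a *: j (s (u n.+1)) by rewrite -(LinZ jL) -(LinZ sL') -auE.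
  rewrite !xE -(LinZ cl2L) => /eq2[m /(_ (maxn m n.+1) (leq_maxl _ _))].
  set k := maxn m n.+1; have nk : (n < k)%N by rewrite leq_max leqnn orbT.
  move=> /(congr1 snd) e2.
  have {e2} : x n + \sum_(n <= m < k) a ^+ (m - n) *: c m =
    a *: (x n.+1 + \sum_(n.+1 <= m < k) a ^+ (m - n.+1) *: c m) by exact: e2.
  rewrite big_ltn // subnn expr0 scale1r scalerDr scaler_sumr.
  rewrite (_ : \sum_(n.+1 <= m < k) a *: _ = \sum_(n.+1 <= m < k) a ^+ (m - n) *: c m); last first.
    rewrite !big_nat; apply: eq_bigr => l /andP[nl _].
    by rewrite scalerA -exprS -subSn.
  rewrite addrA scalerN => /addIr <-.
  by rewrite opprD addrCA subrr addr0.
Qed.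

End Converse.

Lemma contraadjustedP C : contraadjusted C <-> ca C.
Proof.
split=> [H a c|]; last exact: ca_contraadjusted.
have [L [E [iota [f [g [u [loc fg _ sol]]]]]]] := localization_witness a c.
have [s [sL sK]] := Ext1_ses (H a L iota loc) fg.
exact: sol sL sK.
Qed.

(* Dimension shifting without injectives: an extension of N by C embeds in a
   contraadjusted module. *)
Lemma very_flat_syzygy (T : lmodType A) G N (k : N -> G) (p : G -> T) :
  very_flat T -> projective G -> ses k p -> very_flat N.
Proof.
move=> Tv Gp kp C /contraadjustedP cC E f g fL gL fI gS fgE.
case: (kp) => kL pL kI pS kpE.
have [Q [d [dL dI cQ]]] := ca_embed E.
have dfL := Lin_comp fL dL; have dfI : injective (d \o f) by move=> x y /dI/fI.
have [B [b [_ bL _ bS bE]]] := ses_img dfL dfI.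
have cB : ca B by apply: ca_quotient cQ.
have bdf e : g e = 0 -> b (d e) = 0.
  by move=> /fgE[c <-]; apply/bE; exists c.
have [h [hL hE]] := factor_surj gL gS (Lin_comp dL bL) bdf.
have [h1 [h1L h1E]] := Ext1_hom (Tv B (ca_contraadjusted cB)) kp hL.
have [h2 [h2L h2E]] := Gp _ _ b h1 bL bS h1L.
have [|s [sL sE]] := lift_through dL dI (Lin_comp kL h2L).
  move=> x /=; have [e eE] := gS x.
  have /bE[c /= cE] : b (h2 (k x) - d e) = 0.
    by rewrite (LinB bL) h2E h1E -eE hE subrr.
  by exists (f c + e); rewrite (LinD dL) cE subrK.
exists s; split=> // x; have [e eE] := gS x.
have /bE[c /= cE] : b (d (s x - e)) = 0.
  by rewrite (LinB dL) sE (LinB bL) /= h2E h1E -eE hE subrr.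
apply/eqP; rewrite -{2}eE -subr_eq0 -(LinB gL); apply/eqP/fgE; exists c; exact: dI.
Qed.

End Contraadjusted.

(** * Noetherian devissage *)

Section Noetherian.
Variable A : comPzRingType.

(** Choice iterates a counterexample into a strictly ascending chain. The finitely many generators
    of its union all lie in one stage N, so stage N + 1 cannot be larger. *)
Lemma noetherian_ind (Phi : (A -> Prop) -> Prop) : noetherian A ->
  (forall I, is_ideal I ->
     (forall J, is_ideal J -> (forall x, I x -> J x) -> (exists x, J x /\ ~ I x) -> Phi J) ->
     Phi I) ->
  forall I, is_ideal I -> Phi I.
Proof.
move=> nA step I0 idI0; apply: contrapT => bad0.
pose bad := {I : A -> Prop | is_ideal I /\ ~ Phi I}.
have /choice[nx nxP] (I : bad) : exists J : bad,
    (forall x, sval I x -> sval J x) /\ exists x, sval J x /\ ~ sval I x.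
  case: I => I [idI nI] /=; apply: contrapT => H; apply: nI; apply: step => // J idJ IJ JI.
  by apply: contrapT => nJ; apply: H; exists (exist _ J (conj idJ nJ)).
pose c n := sval (iter n nx (exist _ I0 (conj idI0 bad0) : bad)).
have cid n : is_ideal (c n) by rewrite /c; case: (iter _ _ _) => J [].
have cS n x : c n x -> c n.+1 x by move=> cx; apply: (proj1 (nxP _)).
have cle m n x : (m <= n)%N -> c m x -> c n x.
  by move=> /subnKC <-; elim: (n - m)%N => [|d IH]; rewrite ?addn0 // addnS => /IH/cS.
have idU : is_ideal (fun x => exists n, c n x).
  split; first by exists 0; case: (cid 0).
    move=> x y [m cx] [n cy]; exists (maxn m n); case: (cid (maxn m n)) => _ cD _.
    by apply: cD; [apply: cle cx; apply: leq_maxl | apply: cle cy; apply: leq_maxr].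
  by move=> r x [n cx]; exists n; case: (cid n) => _ _; apply.
have [gens gensP] := nA _ idU.
have /choice[f fP] (i : 'I_(size gens)) : exists n, c n gens`_i.
  apply/gensP; exists [seq (j == i :> nat)%:R | j <- iota 0 (size gens)].
  rewrite size_map size_iota; split=> //.
  rewrite (bigD1 i) //= (nth_map 0) ?size_iota // nth_iota // add0n eqxx mul1r.
  rewrite big1 ?addr0 // => j ji.
  rewrite (nth_map 0) ?size_iota // nth_iota // add0n; move: ji; rewrite -val_eqE => /negPf /= ->.
  by rewrite mul0r.
pose N := \max_i f i.
have [_ [x [xS xN]]] := nxP (iter N nx (exist _ I0 (conj idI0 bad0) : bad)).
have /gensP[d [_ dE]] : exists n, c n x by exists N.+1.
case: xN; rewrite -/(c N) dE; case: (cid N) => c0 cD cM.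
apply: big_ind => // i _; apply: cM; apply: (cle (f i)) => //.
exact: (leq_bigmax i).
Qed.

Definition adjoin (I : A -> Prop) (a x : A) := exists s t, I s /\ x = s + t * a.

Lemma adjoin_ideal I a : is_ideal I -> is_ideal (adjoin I a).
Proof.
move=> [I0 ID IM]; split; first by exists 0, 0; rewrite mul0r addr0.
  move=> _ _ [s [t [Is ->]]] [s' [t' [Is' ->]]]; exists (s + s'), (t + t').
  by split; [apply: ID | rewrite mulrDl addrACA].
by move=> r _ [s [t [Is ->]]]; exists (r * s), (r * t); rewrite mulrDr mulrA; split=> //; apply: IM.
Qed.

Lemma sub_adjoin (I : A -> Prop) a x : I x -> adjoin I a x.
Proof. by move=> Ix; exists x, 0; rewrite mul0r addr0. Qed.

Lemma mem_adjoin (I : A -> Prop) a : is_ideal I -> adjoin I a a.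
Proof. by case=> I0 _ _; exists 0, 1; rewrite mul1r add0r. Qed.

Definition killed (I : A -> Prop) (C : lmodType A) := forall a (x : C), I a -> a *: x = 0.

Lemma killed_adjoin I a (C : lmodType A) : killed I C -> (forall x : C, a *: x = 0) ->
  killed (adjoin I a) C.
Proof.
by move=> kI ka _ x [s [t [Is ->]]]; rewrite scalerDl -scalerA ka kI // scaler0 addr0.
Qed.

Lemma killed_quotient I (E L : lmodType A) (g : E -> L) : Lin g -> onto g ->
  killed I E -> killed I L.
Proof. by move=> gL gS kE a l Ia; have [e <-] := gS l; rewrite -(LinZ gL) kE // (Lin0 gL). Qed.

Lemma killed_sub I (E L : lmodType A) (g : E -> L) : Lin g -> injective g ->
  killed I L -> killed I E.
Proof. by move=> gL gI kL a e Ia; apply: gI; rewrite (LinZ gL) kL // (Lin0 gL). Qed.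

Definition regular (c : A) (C : lmodType A) := forall x : C, c *: x = 0 -> x = 0.
Definition divisible (c : A) (C : lmodType A) := forall x : C, exists y, x = c *: y.

Lemma regular_exp c C n : regular c C -> regular (c ^+ n) C.
Proof.
move=> rc; elim: n => [|n IH] x; first by rewrite expr0 scale1r.
by rewrite exprS -scalerA => /rc/IH.
Qed.

Lemma regular_inj c C : regular c C -> injective (fun x : C => c *: x).
Proof.
move=> rc x y /= e; apply/eqP; rewrite -subr_eq0; apply/eqP/rc.
by rewrite scalerBr e subrr.
Qed.

(* P is the pushout of a free R/p-module along the embedding of the kernel K0 of its
   map to C in the reduced power of K0; it stays torsion-free since K0 is pure there. *)
Lemma torsionfree_cover (p : A -> Prop) (C : lmodType A) :
  is_prime_ideal p -> ca C -> killed p C ->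
  exists (K P : lmodType A) (f : K -> P) (g : P -> C),
    [/\ ses f g, ca K /\ ca P, killed p K /\ killed p P &
        forall c, ~ p c -> regular c K /\ regular c P].
Proof.
move=> [[p0 pD pM] p1 pP] cC kC.
have [G [u [co fG]]] := free_exists A C.
have [eps [epsL epsu]] := free_ext fG (@id C).
have coL r x y i : co (r *: x + y) i = r * co x i + co y i by case: fG.
have coZ r x i : co (r *: x) i = r * co x i by apply: (LinZ (co_Lin fG i)).
have sN : submod (fun v => forall i, p (co v i)).
  split=> [i|r x y xp yp i]; first by rewrite (Lin0 (co_Lin fG i)).
  by rewrite coL; apply: pD => //; apply: pM.
have [P0 [q [qL qS qE]]] := quot_lmod sN.
have [|pi [piL piE]] := factor_surj qL qS epsL.
  move=> v /qE vp; have [ys [_ ysE]] := free_support fG [:: v].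
  rewrite (ysE v) ?mem_head // (Lin_sum epsL) big1 // => y _.
  by rewrite (LinZ epsL) epsu kC.
have piS : onto pi by move=> x; exists (q (u x)); rewrite piE epsu.
have kP0 : killed p P0.
  move=> a x pa; have [v <-] := qS x; rewrite -(LinZ qL); apply/qE => i.
  by rewrite coZ mulrC; apply: pM.
have rP0 c : ~ p c -> regular c P0.
  move=> npc x; have [v <-] := qS x; rewrite -(LinZ qL) => /qE vp; apply/qE => i.
  by move: (vp i); rewrite coZ => /pP[].
have [K0 [ka kap]] := ses_ker piL piS; case: (kap) => kaL _ kaI _ kapE.
have rK0 c : ~ p c -> regular c K0.
  move=> npc x cx0; apply: kaI; rewrite (Lin0 kaL); apply: (rP0 c npc).
  by rewrite -(LinZ kaL) cx0 (Lin0 kaL).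
have [K [cl [clL clS cl0]]] := germs K0.
pose d (x : K0) : K := cl (fun=> x).
have dL : Lin d by move=> r x y; rewrite /d -clL.
have kK : killed p K.
  move=> a x pa; have [v <-] := clS x; rewrite -(LinZ clL); apply/cl0; exists 0 => k _.
  exact: (killed_sub kaL kaI kP0).
have rK c : ~ p c -> regular c K.
  move=> npc x; have [v <-] := clS x; rewrite -(LinZ clL) => /cl0[n nE].
  by apply/cl0; exists n => k /nE/(rK0 c npc).
have [P [f [g [j [fg jL gj jk]]]]] := pushout kap dL.
case: (fg) => fL gL fI gS fgE.
have cK : ca K by apply: germ_ca cl0.
have PE x : exists y k, x = j y + f k.
  have [y yE] := piS (g x); have /fgE[k kE] : g (x - j y) = 0 by rewrite (LinB gL) gj yE subrr.
  by exists y, k; rewrite kE addrC subrK.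
exists K, P, f, g; split=> //; first by split=> //; exact: (ca_extension fg cK cC).
  split=> // a x pa; have [y [k ->]] := PE x.
  by rewrite scalerDr -(LinZ jL) -(LinZ fL) kP0 // kK // (Lin0 jL) (Lin0 fL) addr0.
move=> c npc; split=> [|x]; first exact: rK.
have [y [k ->]] := PE x; rewrite scalerDr -(LinZ jL) -(LinZ fL) => cx0.
have /kapE[z zE] : pi (c *: y) = 0.
  by rewrite -gj -[j _](addrK (f (c *: k))) cx0 sub0r (LinN gL) (ses_comp0 fg) oppr0.
have dz : d z + c *: k = 0 by apply: fI; rewrite (LinD fL) -jk zE cx0 (Lin0 fL).
have [v vE] := clS k.
(* Evaluating at one late index turns z = - c v from an equation of germs into one in [K0]; this is
   the purity of [K0] in its reduced power. *)
have /cl0[n /(_ n (leqnn n))] : cl ((fun=> z) + c *: v) = 0 by rewrite (LinD clL) (LinZ clL) vE.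
have -> : ((fun=> z) + c *: v) n = z + c *: v n by [].
move=> zv; have {}zv : z = - (c *: v n) by apply/eqP; rewrite -addr_eq0 zv.
have yv : y = - ka (v n).
  apply: (regular_inj (rP0 c npc)); rewrite /= -zE zv scalerN (LinN kaL) (LinZ kaL).
  by [].
have kv : k = d (v n).
  apply: (regular_inj (rK c npc)); rewrite /= -(LinZ dL) -[c *: v n]opprK -zv (LinN dL).
  by apply/eqP; rewrite -addr_eq0 addrC dz.
by rewrite yv (LinN jL) jk kv addNr.
Qed.

(** * Devissage of contraadjusted modules to modules over (A/p)[1/c] *)

Section Devissage.
Variable Q : lmodType A -> Prop.
Hypothesis Q_zero : forall C : lmodType A, (forall x : C, x = 0) -> Q C.
Hypothesis Q_ext : forall (C E L : lmodType A) (f : C -> E) (g : E -> L),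
  ses f g -> Q C -> Q L -> Q E.
Hypothesis Q_complete : forall (c : A) (D D' : lmodType A) (g : D -> D'),
  Lin g -> onto g -> (forall x, g x = 0 <-> exists y, x = c *: y) ->
  regular c D -> (forall x : D, (forall n, exists y, x = c ^+ n *: y) -> x = 0) ->
  ca D -> Q D' -> Q D.
Hypothesis Q_quot : forall (K P C : lmodType A) (f : K -> P) (g : P -> C),
  ses f g -> Q K -> Q P -> Q C.
Hypothesis Q_generic : forall p : A -> Prop, is_prime_ideal p -> exists c, ~ p c /\
  forall J, killed p J -> ca J -> regular c J -> divisible c J -> Q J.

Lemma devissage_regular (p : A -> Prop) c (P : lmodType A) :
  ca P -> killed p P -> regular c P ->
  (forall C, ca C -> killed (adjoin p c) C -> Q C) ->
  (forall J, killed p J -> ca J -> regular c J -> divisible c J -> Q J) -> Q P.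
Proof.
move=> cP kP rP IH QJ.
have rPn n := regular_inj (regular_exp (n := n) rP).
have sN : submod (fun x : P => forall n, exists y, x = c ^+ n *: y).
  split=> [n|r x y xn yn n]; first by exists 0; rewrite scaler0.
  have [[x' ->] [y' ->]] := (xn n, yn n); exists (r *: x' + y').
  by rewrite scalerDr !scalerA mulrC.
have [J [D [i [q [iq qE]]]]] := ses_sub sN; case: (iq) => iL qL iI qS iqE.
have iE x : (forall n, exists y, x = c ^+ n *: y) <-> exists z, i z = x by rewrite -qE iqE.
have cD : ca D by apply: ca_quotient cP.
have Jdiv (z : J) n : exists y, i z = c ^+ n *: y by apply: (proj2 (iE _)); exists z.
have QD : Q D.
  have sM : submod (fun x : D => exists y, x = c *: y).
    split=> [|r _ _ [x ->] [y ->]]; first by exists 0; rewrite scaler0.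
    by exists (r *: x + y); rewrite scalerDr !scalerA mulrC.
  have [D' [g [gL gS gE]]] := quot_lmod sM.
  apply: (Q_complete gL gS gE) => //.
  - move=> x; have [y <-] := qS x; rewrite -(LinZ qL) => /qE cy; apply/qE => n.
    have [z] := cy n.+1; rewrite exprS -scalerA => /(regular_inj rP) ->.
    by exists z.
  - move=> x; have [y <-] := qS x => yn; apply/qE => n.
    have [z] := yn n; have [w <-] := qS z; rewrite -(LinZ qL) => e.
    have /iqE[t tE] : q (y - c ^+ n *: w) = 0 by rewrite (LinB qL) e subrr.
    have [s sE] := Jdiv t n; exists (s + w).
    by rewrite scalerDr -sE tE subrK.
  - apply: IH; first exact: ca_quotient cD.
    apply: killed_adjoin; first by apply: (killed_quotient gL gS); apply: killed_quotient kP.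
    by move=> x; have [y <-] := gS x; rewrite -(LinZ gL); apply/gE; exists y.
have rJ : regular c J.
  by move=> z; move=> cz0; apply: iI; rewrite (Lin0 iL); apply: rP;
    rewrite -(LinZ iL) cz0 (Lin0 iL).
apply: (Q_ext iq) => //; apply: QJ => //; first exact: killed_sub kP.
- move=> a e.
  (* A solution in P may leave J. With e_n = c^n w_n, solving for w with multiplier c a and
     rescaling gives a solution x_n divisible by c^n; running the recursion d steps ahead makes x_n
     divisible by c^(n+d), so it lies in J. *)
  have /choice[w wE] n : exists w, c ^+ n *: w = i (e n) by have [w] := Jdiv (e n) n; exists w.
  have [y yE] := cP (c * a) w.
  pose x n := c ^+ n *: y n.
  have xE n : x n = i (e n) + a *: x n.+1.
    by rewrite /x {1}yE scalerDr wE !scalerA exprSr mulrA [_ * a]mulrC.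
  have xd d n : exists z, x n = c ^+ (n + d) *: z.
    elim: d n => [|d IHd] n; first by exists (y n); rewrite addn0.
    have [z zE] := IHd n.+1; have [s sE] := Jdiv (e n) (n.+1 + d)%N.
    exists (s + a *: z); rewrite xE zE sE addnS -addSn scalerDr !scalerA.
    by rewrite [a * _]mulrC.
  have /choice[t tE] n : exists t, i t = x n.
    apply/iE => m; have [z zE] := xd m n; exists (c ^+ n *: z).
    by rewrite scalerA -exprD addnC.
  by exists t => n; apply: iI; rewrite (LinD iL) (LinZ iL) !tE.
- move=> z; have [y yE] := Jdiv z 1%N; rewrite expr1 in yE.
  have /iE[t tE] : forall n, exists w, y = c ^+ n *: w.
    move=> n; have [w wE] := Jdiv z n.+1; exists w; apply: (regular_inj rP).
    by rewrite /= -yE wE scalerA exprS.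
  by exists t; apply: iI; rewrite (LinZ iL) tE.
Qed.

Lemma devissage : noetherian A -> forall C, ca C -> Q C.
Proof.
move=> nA; pose Phi I := forall C, ca C -> killed I C -> Q C.
suff H I : is_ideal I -> Phi I.
  move=> C cC; apply: (H (fun x => x = 0)) => //; last by move=> a x ->; rewrite scale0r.
  by split=> // [x y -> ->|r x ->]; rewrite ?addr0 ?mulr0.
apply: (noetherian_ind (Phi := Phi) nA) => {}I idI IH C cC kC.
have IHa a : ~ I a -> forall C, ca C -> killed (adjoin I a) C -> Q C.
  move=> nIa; apply: IH; [exact: adjoin_ideal | exact: sub_adjoin |].
  by exists a; split=> //; apply: mem_adjoin.
have [I1|nI1] := EM (I 1).
  by apply: Q_zero => x; rewrite -[x]scale1r kC.
have [prI|] := EM (forall x y, I (x * y) -> I x \/ I y); last first.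
  move=> /existsNP[a /existsNP[b H]].
  have {H} [Iab nIa nIb] : [/\ I (a * b), ~ I a & ~ I b].
    by split; [apply: contrapT => n; apply: H => /n | move=> n; apply: H; left | move=> n;
      apply: H; right].
  (* When I contains a b but neither factor, C is cut into aC, a quotient of C killed by b, and
     C/aC, killed by a. *)
  have sN : submod (fun x : C => exists y, x = a *: y).
    split=> [|r _ _ [x ->] [y ->]]; first by exists 0; rewrite scaler0.
    by exists (r *: x + y); rewrite scalerDr !scalerA mulrC.
  have [K [D [i [q [iq qE]]]]] := ses_sub sN; case: (iq) => iL qL iI qS iqE.
  have aL : Lin (fun y : C => a *: y) by move=> r x y; rewrite scalerDr !scalerA mulrC.
  have [|h [hL hE]] := lift_through iL iI aL.
    by move=> y; apply/iqE/qE; exists y.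
  have hS : onto h.
    move=> z; have /qE[y yE] : q (i z) = 0 by apply/iqE; exists z.
    by exists y; apply: iI; rewrite hE.
  apply: (Q_ext iq).
    apply: (IHa b) => //; first exact: ca_quotient cC.
    apply: killed_adjoin; first exact: killed_sub kC.
    move=> z; have [y <-] := hS z; apply: iI.
    by rewrite (LinZ iL) hE (Lin0 iL) scalerA mulrC kC.
  apply: (IHa a) => //; first exact: ca_quotient cC.
  apply: killed_adjoin; first exact: killed_quotient kC.
  by move=> z; have [y <-] := qS z; rewrite -(LinZ qL); apply/qE; exists y.
have pI : is_prime_ideal I by [].
have [c [nIc cP]] := Q_generic pI.
have [K [P [f [g [fg [cK cP'] [kK kP] reg]]]]] := torsionfree_cover pI cC kC.
have [rK rP] := reg c nIc.
by apply: (Q_quot fg); apply: devissage_regular (IHa _ nIc) cP.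
Qed.

End Devissage.
End Noetherian.

(** * Systems of equations along a matrix *)

(** Polynomials are taken over nonzero rings, and a prime ideal forces 1 <> 0. An equality of
    structures lets [subst] carry modules, matrices and ideals along. *)
Lemma comNzRing_of (A : comPzRingType) : (1 : A) <> 0 ->
  exists B : comNzRingType, A = B :> comPzRingType.
Proof.
move=> /eqP n; pose B : comNzRingType := HB.pack (GRing.ComPzRing.sort A)
  (GRing.PzSemiRing_isNonZero.Build (GRing.ComPzRing.sort A) n).
by exists B; rewrite /B; case: A n @B => T [].
Qed.

Lemma ideal_sum (A : comPzRingType) (p : A -> Prop) I (s : seq I) (P : pred I) (F : I -> A) :
  is_ideal p -> (forall i, p (F i)) -> p (\sum_(i <- s | P i) F i).
Proof. by move=> [p0 pD _] pF; apply: big_ind. Qed.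

Lemma ideal_mulr (A : comPzRingType) (p : A -> Prop) x r : is_ideal p -> p x -> p (x * r).
Proof. by move=> [_ _ pM] px; rewrite mulrC; apply: pM. Qed.

Lemma ideal_opp (A : comPzRingType) (p : A -> Prop) x : is_ideal p -> p x -> p (- x).
Proof. by move=> [_ _ pM] px; rewrite -mulN1r; apply: pM. Qed.

(* Modulo p, the characteristic polynomial of M is X^m (c - X N(X)) with c nonzero mod p. *)
Lemma Cayley_Hamilton_mod_prime (B : comNzRingType) n (p : B -> Prop) (M : 'M[B]_n.+1) :
  is_prime_ideal p -> exists c m (N : 'M[B]_n.+1), ~ p c /\
    forall i j, p ((M ^+ m * (c%:M - M * N)) i j).
Proof.
move=> [idp p1 pP]; pose chi := char_poly M.
have chi_exm : exists i, `[< ~ p chi`_i >].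
  exists (size chi).-1; apply/asboolP; rewrite -lead_coefE.
  by rewrite (monicP (char_poly_monic M)).
pose m := ex_minn chi_exm.
have [npm pm] : ~ p chi`_m /\ forall i, (i < m)%N -> p chi`_i.
  rewrite /m; case: ex_minnP => k /asboolP npk kmin; split=> // i ik.
  by apply: contrapT => npi; have := kmin i (asboolT npi); rewrite leqNgt ik.
exists chi`_m, m, (- horner_mx M (drop_poly m.+1 chi)); split=> //.
have coefp (t : {poly B}) : (forall i, p t`_i) -> forall i j, p (horner_mx M t i j).
  move=> tp i j; rewrite -[t]coefK poly_def rmorph_sum summxE.
  by apply: ideal_sum => // k; rewrite /= horner_mxZ mxE; apply: ideal_mulr.
have chiE : 'X^m * ((chi`_m)%:P + 'X * drop_poly m.+1 chi) = chi - take_poly m chi.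
  apply/polyP => i; rewrite coefXnM coefB coef_take_poly.
  case: ltnP => im; first by rewrite subrr.
  rewrite subr0 coefD coefC coefXM coef_drop_poly.
  have [->|mi] := eqVneq i m; first by rewrite subnn /= addr0.
  have {}mi : (m < i)%N by rewrite ltn_neqAle eq_sym mi.
  by rewrite subn_eq0 leqNgt mi /= add0r -subnS subnK.
move=> i j; set H := horner_mx M _.
have -> : M ^+ m * ((chi`_m)%:M - M * - H) =
    horner_mx M ('X^m * ((chi`_m)%:P + 'X * drop_poly m.+1 chi)).
  by rewrite rmorphM rmorphXn rmorphD rmorphM /= !horner_mx_X horner_mx_C mulrN opprK.
rewrite chiE rmorphB /= Cayley_Hamilton sub0r mxE.
apply: ideal_opp => //; apply: coefp => k; rewrite coef_take_poly.
by case: ltnP => [/pm|] //; case: idp.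
Qed.

Section MatrixAction.
Variable A : comPzRingType.
Implicit Types C : lmodType A.

Definition mact m n C (M : 'M[A]_(m, n)) (v : 'I_n -> C) : 'I_m -> C :=
  fun i => \sum_j M i j *: v j.

Lemma mactD m n C (M : 'M[A]_(m, n)) (v w : 'I_n -> C) i :
  mact M (fun j => v j + w j) i = mact M v i + mact M w i.
Proof. by rewrite /mact -big_split; apply: eq_bigr => j _; rewrite scalerDr. Qed.

Lemma mactZ m n C (M : 'M[A]_(m, n)) a (v : 'I_n -> C) i :
  mact M (fun j => a *: v j) i = a *: mact M v i.
Proof. by rewrite /mact scaler_sumr; apply: eq_bigr => j _; rewrite !scalerA mulrC. Qed.

Lemma mactB m n C (M : 'M[A]_(m, n)) (v w : 'I_n -> C) i :
  mact M (fun j => v j - w j) i = mact M v i - mact M w i.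
Proof.
by rewrite /mact -sumrB; apply: eq_bigr => j _; rewrite scalerBr.
Qed.

Lemma mact_Lin m n C C' (f : C -> C') (M : 'M[A]_(m, n)) v i : Lin f ->
  f (mact M v i) = mact M (f \o v) i.
Proof. by move=> fL; rewrite /mact (Lin_sum fL); apply: eq_bigr => j _; rewrite (LinZ fL). Qed.

Lemma mactM m n l C (M : 'M[A]_(m, n)) (N : 'M[A]_(n, l)) (v : 'I_l -> C) i :
  mact (M *m N) v i = mact M (mact N v) i.
Proof.
rewrite /mact; under eq_bigr => j _ do rewrite mxE scaler_suml.
rewrite exchange_big; apply: eq_bigr => k _; rewrite scaler_sumr.
by apply: eq_bigr => j _; rewrite scalerA.
Qed.

Lemma mact_scalar n C a (v : 'I_n -> C) i : mact (a%:M : 'M[A]_n) v i = a *: v i.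
Proof.
rewrite /mact (bigD1 i) //= big1 ?addr0 ?mxE ?eqxx // => j ji.
by rewrite mxE eq_sym (negPf ji) scale0r.
Qed.

Lemma mactBm m n C (M N : 'M[A]_(m, n)) (v : 'I_n -> C) i :
  mact (M - N) v i = mact M v i - mact N v i.
Proof. by rewrite /mact -sumrB; apply: eq_bigr => j _; rewrite !mxE scalerBl. Qed.

Lemma mact0m m n C (v : 'I_n -> C) i : mact (0 : 'M[A]_(m, n)) v i = 0.
Proof. by rewrite /mact big1 // => j _; rewrite mxE scale0r. Qed.

End MatrixAction.

Section MatrixSystems.
Variables (A : comPzRingType) (n : nat).
Implicit Types (M N : 'M[A]_n) (C E L D : lmodType A).

(* [ca] with the localization A[1/a] replaced by colim(A^n -> A^n -> ...) along M. *)
Definition matrix_ca M C := forall e : nat -> 'I_n -> C,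
  exists x : nat -> 'I_n -> C, forall k i, x k i = e k i + mact M (x k.+1) i.

Lemma matrix_ca_extension M C E L (f : C -> E) (g : E -> L) :
  ses f g -> matrix_ca M C -> matrix_ca M L -> matrix_ca M E.
Proof.
move=> fg cC cL c; case: (fg) => fL gL fI gS fgE.
have [s sK] := choice gS; have [y yE] := cL (fun k => g \o c k).
have /choice[d dE] (ki : nat * 'I_n) :
    exists d, f d = c ki.1 ki.2 + mact M (s \o y ki.1.+1) ki.2 - s (y ki.1 ki.2).
  apply/fgE; rewrite (LinB gL) (LinD gL) (mact_Lin _ _ _ gL) sK [in X in _ - X]yE.
  by rewrite (_ : g \o _ = y ki.1.+1) ?subrr //; apply/funext => j /=; rewrite sK.
have [z zE] := cC (fun k i => d (k, i)); exists (fun k i => s (y k i) + f (z k i)) => k i.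
rewrite zE (LinD fL) (mact_Lin _ _ _ fL) dE /= mactD.
by rewrite addrA [s (y k i) + _]addrC subrK addrA.
Qed.

Lemma matrix_ca_quotient M E L (g : E -> L) : Lin g -> onto g -> matrix_ca M E -> matrix_ca M L.
Proof.
move=> gL gS cE c; have [s sK] := choice gS.
have [x xE] := cE (fun k => s \o c k); exists (fun k => g \o x k) => k i /=.
by rewrite xE (LinD gL) (mact_Lin _ _ _ gL) /= sK.
Qed.

(** Successive approximation: a solution modulo c leaves an error c e', and e' is the right-hand
    side of the next system. *)
Lemma matrix_ca_complete M c D D' (g : D -> D') :
  Lin g -> onto g -> (forall x, g x = 0 <-> exists y, x = c *: y) ->
  regular c D -> (forall x : D, (forall m, exists y, x = c ^+ m *: y) -> x = 0) ->
  ca D -> matrix_ca M D' -> matrix_ca M D.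
Proof.
move=> gL gS gE _ sep cD cD' e0; have [s sK] := choice gS.
have /choice[st stP] (e : nat -> 'I_n -> D) : exists xe : (nat -> 'I_n -> D) * (nat -> 'I_n -> D),
    forall k i, e k i + mact M (xe.1 k.+1) i - xe.1 k i = c *: xe.2 k i.
  have [y yE] := cD' (fun k => g \o e k).
  have /choice[d dE] (ki : nat * 'I_n) : exists d,
      e ki.1 ki.2 + mact M (s \o y ki.1.+1) ki.2 - s (y ki.1 ki.2) = c *: d.
    apply/gE; rewrite (LinB gL) (LinD gL) (mact_Lin _ _ _ gL) sK [in X in _ - X]yE.
    by rewrite (_ : g \o _ = y ki.1.+1) ?subrr //; apply/funext => j /=; rewrite sK.
  by exists (fun k => s \o y k, fun k i => d (k, i)) => k i; apply: (dE (k, i)).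
pose e t := iter t (fun e => (st e).2) e0.
pose x t := (st (e t)).1.
have eE t k i : e t k i + mact M (x t k.+1) i - x t k i = c *: e t.+1 k i by apply: stP.
(* Scalar systems with multiplier c sum the series of the c^t x_t entry by entry. The defect of the
   sum is c^m times the defect from stage m on, for every m, so it vanishes by separatedness. *)
have /choice[y yE] (ki : nat * 'I_n) : exists y : nat -> D,
    forall t, y t = x t ki.1 ki.2 + c *: y t.+1 by apply: cD.
pose Y t k i := y (k, i) t.
have YE t k i : Y t k i = x t k i + c *: Y t.+1 k i by apply: yE.
exists (Y 0) => k i; apply/esym/eqP; rewrite -subr_eq0; apply/eqP/sep => m.
have stepE t : e t k i + mact M (Y t k.+1) i - Y t k i =
    c *: (e t.+1 k i + mact M (Y t.+1 k.+1) i - Y t.+1 k i).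
  have -> : mact M (Y t k.+1) i = mact M (x t k.+1) i + c *: mact M (Y t.+1 k.+1) i.
    by rewrite -mactZ -mactD; congr (mact _ _ _); apply/funext => j; apply: YE.
  rewrite YE scalerBr scalerDr -eE opprD !addrA; congr (_ - _).
  by rewrite [RHS]addrAC.
exists (e m k i + mact M (Y m k.+1) i - Y m k i); rewrite -[e0]/(e 0).
by elim: m => [|m ->]; rewrite ?expr0 ?scale1r // exprSr -scalerA -stepE.
Qed.

End MatrixSystems.

(** As in Fitting's decomposition, once M^m has been applied N/c inverts M modulo p. There the
    backward recursion is run forward from y_0 = 0, and the first m terms of the series are written
    out. *)
Lemma matrix_ca_generic (A : comPzRingType) n (M : 'M[A]_n.+1) (p : A -> Prop) :
  is_prime_ideal p -> exists c, ~ p c /\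
  forall J, killed p J -> ca J -> regular c J -> divisible c J -> matrix_ca M J.
Proof.
move=> pP; case: (pP) => idp p1 _.
have [|B BE] := @comNzRing_of A; first by move=> e; apply: p1; rewrite e; case: idp.
subst A; have [c [m [N [npc MN]]]] := Cayley_Hamilton_mod_prime M pP.
exists c; split=> // J kJ _ rJ /choice[d dE] e.
(* The pair carries the step number, because step k uses e_(k+m). *)
pose y k := iter k (fun ky : nat * ('I_n.+1 -> J) => (ky.1.+1,
  fun i => d (mact N (fun j => ky.2 j - e (ky.1 + m)%N j) i))) (0%N, fun=> 0).
have y1 k : (y k).1 = k by rewrite /y; elim: k => //= k ->.
have y2 k i : c *: (y k.+1).2 i = mact N (fun j => (y k).2 j - e (k + m)%N j) i.
  by rewrite [y k.+1]iterS -/(y k) /= y1 -dE.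
(* With this x the equation becomes M^m (y_k - e_(k+m) - M y_(k+1)) = 0, which follows
   from c y_(k+1) = N (y_k - e_(k+m)) and M^m (c - M N) = 0. *)
pose x k i := \sum_(0 <= l < m) mact (M ^+ l) (e (k + l)%N) i + mact (M ^+ m) (y k).2 i.
exists x => k i.
pose w j := (y k).2 j - e (k + m)%N j - mact M (y k.+1).2 j.
have w0 : mact (M ^+ m) w i = 0.
  apply: rJ; rewrite -mactZ.
  rewrite (_ : (fun j => c *: w j) = mact (c%:M - M * N) (fun j => (y k).2 j - e (k + m)%N j)).
    by rewrite -mactM /mact big1 // => j _; apply: kJ.
  apply/funext => j; rewrite /w scalerBr -mactZ mactBm mact_scalar mactM.
  by congr (_ - mact _ _ _); apply/funext => j'; rewrite y2.
have -> : mact M (x k.+1) i = \sum_(0 <= l < m) mact (M ^+ l.+1) (e (k + l.+1)%N) i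
    + mact (M ^+ m) (mact M (y k.+1).2) i.
  rewrite mactD -mactM -mactM -[M *m _]exprS -[_ *m M]exprSr; congr (_ + _).
  rewrite /mact; under eq_bigr => j _ do rewrite scaler_sumr.
  rewrite exchange_big; apply: eq_bigr => l _.
  by rewrite [LHS](_ : _ = mact M (mact (M ^+ l) (e (k.+1 + l)%N)) i) // -mactM exprS addnS.
have -> : mact (M ^+ m) (mact M (y k.+1).2) i = mact (M ^+ m) (y k).2 i - mact (M ^+ m) (e (k +
  m)%N) i.
  by apply/esym; rewrite -mactB; apply: subr0_eq; rewrite -mactB.
have shift : e k i + \sum_(0 <= l < m) mact (M ^+ l.+1) (e (k + l.+1)%N) i =
    \sum_(0 <= l < m) mact (M ^+ l) (e (k + l)%N) i + mact (M ^+ m) (e (k + m)%N) i.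
  rewrite -big_nat_recr //= big_nat_recl //=; congr (_ + _).
  by rewrite addn0 expr0 mact_scalar scale1r.
by rewrite addrA shift -addrA [X in _ + X]addrC subrK.
Qed.

Lemma ca_matrix_ca (A : comPzRingType) n (M : 'M[A]_n.+1) (C : lmodType A) :
  noetherian A -> ca C -> matrix_ca M C.
Proof.
move=> nA; move: C; apply: (@devissage A (matrix_ca M)) => //.
- by move=> C C0 e; exists (fun _ _ => 0) => k i; rewrite (C0 (_ + _)).
- by move=> C E L f g; apply: matrix_ca_extension.
- by move=> c D D' g; apply: matrix_ca_complete.
- by move=> K P C f g [_ gL _ gS _] _; apply: matrix_ca_quotient.
- by move=> p; apply: matrix_ca_generic.
Qed.

(** * Flatness and base change *)

Section Flat.
Variable A : comPzRingType.
Implicit Types (F G K : lmodType A).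

(** The equational criterion of flatness. Free of tensor products, it can be checked on syzygies and
    applied to relations over S. *)
Definition eq_flat F := forall l n (a : 'M[A]_(l, n)) (v : 'I_n -> F),
  (forall i, mact a v i = 0) ->
  exists m (b : 'M[A]_(n, m)) (w : 'I_m -> F), (forall i, v i = mact b w i) /\ a *m b = 0.

(** Rows are treated one at a time: a factorization v = b w for the lower rows turns the top row a_0
    into the relation a_0 b on w, and the one-row criterion refines w. *)
Lemma eq_flat_of_row F :
  (forall n (a : 'rV[A]_n) (v : 'I_n -> F), mact a v 0 = 0 ->
   exists m (b : 'M[A]_(n, m)) (w : 'I_m -> F), (forall i, v i = mact b w i) /\ a *m b = 0) ->
  eq_flat F.
Proof.
move=> H; elim=> [|l IH] n a v av.
  exists n, 1%:M, v; split=> [i|]; first by rewrite mact_scalar scale1r.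
  by apply/matrixP => -[].
have [m [b [w [vE ab]]]] : exists m (b : 'M[A]_(n, m)) (w : 'I_m -> F),
    (forall i, v i = mact b w i) /\ dsubmx (a : 'M_(1 + l, n)) *m b = 0.
  apply: IH => i; rewrite -[RHS](av (rshift 1 i)) /mact.
  by apply: eq_bigr => j _; rewrite mxE.
have [|m' [b' [w' [wE ab']]]] := H m (usubmx (a : 'M_(1 + l, n)) *m b) w.
  rewrite mactM -[RHS](av (lshift l (0 : 'I_1))) /mact; apply: eq_bigr => j _.
  by rewrite mxE vE.
exists m', (b *m b'), w'; split=> [i|].
  by rewrite mactM vE; congr (mact _ _ _); apply/funext.
have -> : a *m (b *m b') = col_mx (usubmx (a : 'M_(1 + l, n)) *m (b *m b'))
    (dsubmx (a : 'M_(1 + l, n)) *m (b *m b')) by rewrite -mul_col_mx vsubmxK.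
by rewrite !mulmxA ab ab' mul0mx; apply: (@col_mx0 _ 1 l).
Qed.

Lemma flat_eq_flat F : flat F -> eq_flat F.
Proof.
move=> fF; apply: eq_flat_of_row => n a v av.
(* I (x) F is built from the presentation of the ideal I of the entries of a as the
   quotient T of F^n by the products of linear relations of a with elements of F. *)
pose lin (r : 'I_n -> A) := \sum_i r i * a 0 i.
have sI : submod (fun x : A^o => exists r, lin r = x).
  split=> [|r _ _ [s <-] [t <-]]; first by exists (fun=> 0); rewrite /lin big1 // => i _;
    rewrite mul0r.
  exists (fun i => r * s i + t i); rewrite /lin {1}/GRing.scale /= mulr_sumr -big_split.
  by apply: eq_bigr => i _; rewrite mulrDl mulrA.
have [I [io [ioL ioI ioE]]] := sub_lmod sI.
have /choice[rep repE] x : exists r, lin r = io x by apply/ioE; exists x.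
have /choice[g gE] i : exists g, io g = a 0 i.
  apply/ioE; exists (fun j => (j == i)%:R).
  rewrite /lin (bigD1 i) //= eqxx mul1r big1 ?addr0 // => j /negPf ->.
  by rewrite mul0r.
have lin_g r x : lin r = io x -> x = \sum_i r i *: g i.
  move=> rx; apply: ioI; rewrite -rx (Lin_sum ioL); apply: eq_bigr => i _.
  by rewrite (LinZ ioL) gE.
pose rel := {r : 'I_n -> A | lin r = 0}.
pose u (rx : rel * F) : ('I_n -> F : lmodType A) := fun i => sval rx.1 i *: rx.2.
have [T [cl [clL clS clE]]] := quot_lmod (submod_span u).
have clu r x : lin r = 0 -> cl (fun i => r i *: x) = 0.
  move=> r0; apply/clE; exists [:: (1, (exist _ r r0 : rel, x))].
  by rewrite eval_1.
pose b (m : I) (x : F) := cl (fun i => rep m i *: x).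
have bE m x r : lin r = io m -> b m x = cl (fun i => r i *: x).
  move=> rm; apply: subr0_eq; rewrite -(LinB clL).
  rewrite [X in cl X](_ : _ = fun i => (rep m i - r i) *: x); last first.
    by apply/funext => i; rewrite scalerBl.
  apply: clu; rewrite /lin; under eq_bigr => i _ do rewrite mulrBl.
  by rewrite sumrB -/(lin _) -/(lin _) repE rm subrr.
have bB : Bilin b.
  split=> [x|m] r y z; last first.
    rewrite -clL; congr cl; apply/funext => i.
    have -> : (r *: (fun i => rep m i *: y) + (fun i => rep m i *: z) : 'I_n -> F) i =
      r *: (rep m i *: y) + rep m i *: z by [].
    by rewrite scalerDr !scalerA mulrC.
  rewrite (@bE _ _ (fun i => r * rep y i + rep z i)); last first.
    rewrite ioL -!repE /lin {1}/GRing.scale /= mulr_sumr -big_split.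
    by apply: eq_bigr => i _; rewrite mulrDl mulrA.
  rewrite -clL; congr cl; apply/funext => i.
  by rewrite scalerDl -scalerA.
have clg w : cl w = \sum_i b (g i) (w i).
  have e i : b (g i) (w i) = cl (fun j => (j == i)%:R *: w i).
    apply: bE; rewrite gE /lin (bigD1 i) //= eqxx mul1r big1 ?addr0 // => j /negPf ->.
    by rewrite mul0r.
  rewrite (eq_bigr _ (fun i _ => e i)) -(Lin_sum clL); congr cl; apply/funext => j.
  rewrite fct_sumE (bigD1 j) //= eqxx scale1r big1 ?addr0 // => i; rewrite eq_sym => /negPf ->.
  by rewrite scale0r.
have bT : IsTensor b.
  split=> // P h [h1 h2].
  have hL : Lin (fun w : ('I_n -> F : lmodType A) => \sum_i h (g i) (w i)).
    move=> r x y; rewrite scaler_sumr -big_split; apply: eq_bigr => i _.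
    exact: (h2 (g i) r (x i) (y i)).
  have [|f [fL fE]] := factor_surj clL clS hL.
    move=> w /clE[l <-]; rewrite (eval_Lin u l hL) /eval big1 // => -[c [[r r0] x]] _ /=.
    under eq_bigr => i _ do rewrite (LinZ (h2 _)) -(LinZ (h1 _)).
    rewrite -(Lin_sum (h1 x)) -(@lin_g r 0) ?(Lin0 ioL) //.
    by rewrite (Lin0 (h1 x)) scaler0.
  exists f; split=> // [m x|psi psiL psiE t].
    rewrite fE; under eq_bigr => i _ do rewrite (LinZ (h2 _)) -(LinZ (h1 _)).
    by rewrite -(Lin_sum (h1 x)) -(@lin_g (rep m) m).
  have [w <-] := clS t; rewrite clg (Lin_sum psiL) (Lin_sum fL).
  apply: eq_bigr => i _; rewrite psiE fE.
  under eq_bigr => j _ do rewrite (LinZ (h2 _)) -(LinZ (h1 _)).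
  by rewrite -(Lin_sum (h1 _)) -(@lin_g (rep (g i)) (g i)).
have b'T : @IsTensor A A^o F F (fun r x => r *: x).
  split=> [|P h [h1 h2]].
    split=> [x|m] r y z; last by rewrite scalerDr !scalerA mulrC.
    by rewrite [r *: y]/GRing.scale /= scalerDl scalerA.
  exists (h 1); split=> // [m x|psi psiL psiE t]; last by rewrite -[t in LHS]scale1r psiE.
  by rewrite (LinZ (h2 1)) -(LinZ (h1 x)) /GRing.scale /= mulr1.
have sumL : Lin (fun w : ('I_n -> F : lmodType A) => \sum_i a 0 i *: w i).
  move=> r x y; rewrite scaler_sumr -big_split; apply: eq_bigr => i _ /=.
  have -> : (r *: x + y) i = r *: x i + y i by [].
  by rewrite scalerDr !scalerA mulrC.
have [|f [fL fE]] := factor_surj clL clS sumL.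
  move=> w /clE[l <-]; rewrite (eval_Lin u l sumL) /eval big1 // => -[c [[r r0] x]] _ /=.
  under eq_bigr => i _ do rewrite scalerA mulrC.
  by rewrite -scaler_suml -/(lin r) r0 scale0r scaler0.
(* [f] is the map I (x) F -> A (x) F = F induced by the inclusion of the ideal. *)
have fI : injective f.
  apply: (fF _ _ io ioL ioI _ _ _ _ bT b'T f fL) => m x.
  rewrite fE -repE scaler_suml; apply: eq_bigr => i _.
  by rewrite scalerA mulrC.
(* Since v dies in F, it dies already in I (x) F, so v is a sum of terms r x with r a linear
   relation of a. The relations become the columns of b and the x the new vectors. *)
have /clE[l lE] : cl v = 0 by apply: fI; rewrite (Lin0 fL) fE.
pose t j := tnth (in_tuple l) j.
exists (size l), (\matrix_(i, j) ((t j).1 * sval (t j).2.1 i)), (fun j => (t j).2.2).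
split=> [i|].
  rewrite -lE /eval fct_sumE big_tnth; apply: eq_bigr => j _.
  by rewrite mxE -scalerA.
apply/matrixP => i j; rewrite !mxE ord1.
under eq_bigr => k _ do rewrite mxE mulrCA [a 0 k * _]mulrC.
by rewrite -mulr_sumr -/(lin _) (svalP (t j).2.1) mulr0.
Qed.

Lemma free_eq_flat (I : eqType) G (u : I -> G) co : is_free u co -> eq_flat G.
Proof.
move=> fG l n a v av; have [ys [_ ysE]] := free_support fG [seq v i | i <- enum 'I_n].
pose t j := tnth (in_tuple ys) j.
exists (size ys), (\matrix_(i, j) co (v i) (t j)), (u \o t); split=> [i|].
  rewrite {1}(ysE (v i)) ?map_f ?mem_enum // big_tnth.
  by apply: eq_bigr => j _; rewrite mxE.
apply/matrixP => i j; rewrite !mxE.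
transitivity (co (mact a v i) (t j)); last by rewrite av (Lin0 (co_Lin fG _)).
rewrite (Lin_sum (co_Lin fG (t j))); apply: eq_bigr => k _.
by rewrite mxE (LinZ (co_Lin fG (t j))).
Qed.

(** In G the criterion gives v = b w, and p w satisfies the relation b. Factoring p w = b' w' in F
    with b b' = 0 and subtracting a lift of b' w' moves w into K without changing b w. *)
Lemma eq_flat_syzygy G K F (k : K -> G) (p : G -> F) : ses k p ->
  eq_flat G -> eq_flat F -> eq_flat K.
Proof.
move=> [kL pL kI pS kpE] fG fF l n a v av.
have [|m [b [w [wE ab]]]] := fG l n a (k \o v).
  by move=> i; rewrite -(mact_Lin _ _ _ kL) av (Lin0 kL).
have [|m' [b' [w' [wE' bb']]]] := fF n m b (p \o w).
  by move=> i; rewrite -(mact_Lin _ _ _ pL) -wE; apply/kpE; exists (v i).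
have [s sK] := choice pS.
have /choice[z zE] i : exists z, k z = w i - mact b' (s \o w') i.
  apply/kpE; rewrite (LinB pL) (mact_Lin _ _ _ pL) -[p (w i)]/((p \o w) i) wE'.
  by rewrite (_ : p \o _ = w') ?subrr //; apply/funext => j /=; rewrite sK.
exists m, b, z; split=> // i; apply: kI; rewrite (mact_Lin _ _ _ kL) -[k (v i)]/((k \o v) i) wE.
rewrite (_ : k \o z = fun j => w j - mact b' (s \o w') j); last by apply/funext => j /=.
by rewrite mactB -mactM bb' mact0m subr0.
Qed.

End Flat.

Section BaseChange.
Variables (R S : comPzRingType) (phi : {rmorphism R -> S}).

(** The projection of T modulo the span and the zero map both extend the zero map of F, so they
    agree by uniqueness. *)
Lemma base_change_span (F : lmodType R) (T : lmodType S) (j : F -> T) :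
  IsBaseChange phi j -> forall t, exists l, eval j l = t.
Proof.
move=> [jL jU] t; have [Q [q [qL _ qE]]] := quot_lmod (submod_span j).
have [g [gL g0 gU]] := jU Q (fun=> 0) (fun r x y => esym (etrans (congr2 +%R (scaler0 _ _) erefl)
  (addr0 0))).
apply/qE; rewrite (gU q) //; first by rewrite -(gU (fun=> 0)) //; apply: Lin_0.
by move=> x; apply/qE; exists [:: (1, x)]; rewrite eval_1.
Qed.

(** [K'] is the submodule of [G'] generated by the d (k x), so [k'] is injective by construction.
    The content is that [K'] is the base change of [K]: the vanishing of Tor_1(S, F) in equational
    form. *)
Lemma base_change_presentation (F : lmodType R) (T : lmodType S) (j : F -> T) :
  eq_flat F -> IsBaseChange phi j ->
  exists (G K : lmodType R) (k : K -> G) (p : G -> F) (G' K' : lmodType S)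
    (k' : K' -> G') (p' : G' -> T) (d : G -> G') (j' : K -> K'),
  [/\ projective G, ses k p /\ eq_flat K, projective G', ses k' p' &
      [/\ RLin phi d, IsBaseChange phi j' & forall x, d (k x) = k' (j' x)]].
Proof.
move=> fF bT; case: (bT) => jL jU.
have [G [K [u [co [k [p [fG kp pu]]]]]]] := free_presentation F.
case: (kp) => kL pL kI pS kpE.
have [G' [u' [co' fG']]] := free_exists S F.
have [d [dL du dR]] : exists d : G -> G',
    [/\ Lin (d : G -> restr phi G'), forall x, d (u x) = u' x & RLin phi d].
  by have [d [dL du]] := free_ext fG (u' : F -> restr phi G'); exists d.
have uS : forall g, exists l, eval u l = g by case: fG.
have co'd g y : co' (d g) y = phi (co g y).
  have L1 : Lin (fun g => co' (d g) y : restr phi S^o).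
    by move=> r a b; rewrite dR; case: fG' => _ -> _ _.
  have L2 : Lin (fun g => phi (co g y) : restr phi S^o).
    move=> r a b; case: (fG) => _ -> _ _; rewrite rmorphD rmorphM; by [].
  apply: (span_eq uS L1 L2) => i; rewrite du.
  by case: fG' => _ _ -> _; case: fG => _ _ -> _; rewrite rmorph_nat.
have [p' [p'L p'u]] := free_ext fG' j.
have p'd g : p' (d g) = j (p g).
  have L1 : Lin (fun g => p' (d g) : restr phi T).
    by move=> r a b; rewrite dR p'L.
  have L2 : Lin (fun g => j (p g) : restr phi T).
    by move=> r a b; rewrite pL jL.
  by apply: (span_eq uS L1 L2) => i; rewrite du p'u pu.
have [K' [k' [k'L k'I k'E]]] := sub_lmod (submod_span (fun x => d (k x))).
have /choice[j' j'E] x : exists y, k' y = d (k x).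
  by apply/k'E; exists [:: (1, x)]; rewrite eval_1.
have j'L : RLin phi j'.
  by move=> r x y; apply: k'I; rewrite k'L !j'E kL dR.
have j'S m : exists l, eval j' l = m.
  have [l lE] : exists l, eval (fun x => d (k x)) l = k' m by apply/k'E; exists m.
  exists l; apply: k'I; rewrite (eval_Lin _ _ k'L) -lE.
  by apply: eq_bigr => q _ /=; rewrite j'E.
have bK : IsBaseChange phi j'.
  split=> // P h hL.
  have [l l0|f [fL fE]] := span_ext (u := j') (h := h) j'S; last first.
    by exists f; split=> // f' f'L f'E; apply: (span_eq j'S) => // x; rewrite f'E fE.
  have {}l0 : eval (fun x => d (k x)) l = 0.
    rewrite -(Lin0 k'L) -l0 (eval_Lin _ _ k'L).
    by apply: eq_bigr => q _ /=; rewrite j'E.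
  (* A relation among the d (k x_t) must hold among the h x_t. The coordinates of the k x_t form a
     matrix a with a y = 0 in F; the criterion gives y = b w with a b = 0, hence x = a om with om in
     K. The S-coefficients of the h om_i are then coordinates of the relation in [G'], which
     vanish. *)
  have [ys [Uy ysE]] := free_support fG [seq k q.2 | q <- l].
  pose x t := (tnth (in_tuple l) t).2; pose y i := tnth (in_tuple ys) i.
  pose s t := (tnth (in_tuple l) t).1.
  pose a := \matrix_(t < size l, i < size ys) co (k (x t)) (y i).
  have kxE t : k (x t) = \sum_i a t i *: u (y i).
    have /ysE kE : k (x t) \in [seq k q.2 | q <- l].
      by apply/mapP; exists (tnth (in_tuple l) t) => //; apply: mem_tnth.
    rewrite [LHS]kE [LHS]big_tnth.
    by apply: eq_bigr => i _; rewrite mxE.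
  have [|m [b [w [yE ab]]]] := fF _ _ a y.
    move=> t; rewrite -[RHS](ses_comp0 kp (x t)) kxE (Lin_sum pL).
    by apply: eq_bigr => i _; rewrite (LinZ pL) pu.
  have /choice[om omE] i : exists z, k z = u (y i) - mact b (u \o w) i.
    apply/kpE; rewrite (LinB pL) pu (mact_Lin _ _ _ pL) yE.
    by rewrite (_ : p \o _ = w) ?subrr //; apply/funext => i' /=; rewrite pu.
  have xE t : x t = mact a om t.
    apply: kI; rewrite (mact_Lin _ _ _ kL) kxE.
    rewrite (_ : k \o om = fun i => u (y i) - mact b (u \o w) i); last by apply/funext => i /=.
    by rewrite mactB -mactM ab mact0m subr0.
  have hx t : h (x t) = \sum_i phi (a t i) *: h (om i).
    have hL' : Lin (h : K -> restr phi P) by [].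
    rewrite xE [LHS](Lin_sum hL'); apply: eq_bigr => i _; exact: (LinZ hL').
  rewrite /eval big_tnth; under eq_bigr => t _ do rewrite -/(s t) -/(x t) hx scaler_sumr.
  rewrite exchange_big big1 // => i _.
  under eq_bigr => t _ do rewrite scalerA.
  rewrite -scaler_suml (_ : \sum_t _ = 0) ?scale0r //.
  transitivity (co' (eval (fun x => d (k x)) l) (y i)); last by rewrite l0 (Lin0 (co_Lin fG' _)).
  rewrite (Lin_sum (co_Lin fG' _)) [RHS]big_tnth; apply: eq_bigr => t _.
  by rewrite (LinZ (co_Lin fG' _)) co'd mxE.
exists G, K, k, p, G', K', k', p', d, j'; split=> //.
- exact: free_projective fG.
- split=> //; apply: eq_flat_syzygy kp _ fF; exact: free_eq_flat fG.
- exact: free_projective fG'.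
split=> //.
  move=> t; have [l <-] := base_change_span bT t; exists (eval u' l).
  by rewrite (eval_Lin _ _ p'L); apply: eq_bigr => q _ /=; rewrite p'u.
move=> e; split=> [pe|[m <-]]; last first.
  have [l <-] := j'S m; rewrite (eval_Lin _ _ k'L) (eval_Lin _ _ p'L) /eval big1 // => q _ /=.
  by rewrite j'E p'd (ses_comp0 kp) (Lin0 (jL : Lin (j : F -> restr phi T))) scaler0.
(* Exactness at [G']: modulo [K'] the map [u'] becomes R-linear, so it factors through T, and the
   kernel of [p'] falls into [K']. *)
have [Q [q qk]] := ses_img k'L k'I; case: (qk) => _ qL _ qS qE.
have hL : RLin phi (fun x => q (u' x)).
  move=> r x y; apply: subr0_eq; rewrite -(LinZ qL) -(LinD qL) -(LinB qL) -!du -dR.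
  have -> : d (u (r *: x + y)) - d (r *: u x + u y) = d (u (r *: x + y) - (r *: u x + u y)).
    by rewrite [RHS](LinB (dL : Lin (d : G -> restr phi G'))).
  have /kpE[z <-] : p (u (r *: x + y) - (r *: u x + u y)) = 0.
    by rewrite (LinB pL) pL !pu subrr.
  by rewrite -j'E (ses_comp0 qk).
have [g [gL gE _]] := jU Q _ hL.
have qE' v : g (p' v) = q v.
  have u'S : forall g, exists l, eval u' l = g by case: fG'.
  by apply: (span_eq u'S (Lin_comp p'L gL) qL) => x /=; rewrite p'u gE.
by apply/qE; rewrite -qE' pe (Lin0 gL).
by split=> // x; rewrite j'E.
Qed.

(** T is existential so that the notion passes to syzygies, whose base change is another module. *)
Definition good (F : lmodType R) := eq_flat F /\
  exists (T : lmodType S) (j : F -> T), IsBaseChange phi j /\ very_flat T.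

Lemma good_presentation F : good F -> exists (G K : lmodType R) (k : K -> G) (p : G -> F),
  [/\ projective G, ses k p & good K].
Proof.
move=> [fF [T [j [bT vT]]]].
have [G [K [k [p [G' [K' [k' [p' [d [j' [Gp [kp fK] G'p kp' [_ bK _]]]]]]]]]]]] :=
  base_change_presentation fF bT.
exists G, K, k, p; split=> //; split=> //; exists K', j'; split=> //.
exact: very_flat_syzygy vT G'p kp'.
Qed.

(* Ext^1_R(F, X) = Ext^1_S(S (x) F, X) for an S-module X, since F is flat. *)
Lemma good_Ext1 F (X : lmodType S) : good F -> ca X -> Ext1_vanishes F (restr phi X).
Proof.
move=> [fF [T [j [bT vT]]]] cX.
have [G [K [k [p [G' [K' [k' [p' [d [j' [Gp [kp fK] G'p kp' [dL [_ bK] dk]]]]]]]]]]]] :=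
  base_change_presentation fF bT.
apply: (hom_Ext1 Gp kp) => h hL; have [f [fL fE _]] := bK X h hL.
have [g [gL gE]] := Ext1_hom (vT X (ca_contraadjusted cX)) kp' fL.
exists (fun x => g (d x)); split=> [r x y|x]; first by rewrite dL gL.
by rewrite dk gE fE.
Qed.

(** A contraadjusted S-module is contraadjusted over R, its systems at a being those at phi a. Very
    flatness of F lifts [j] over R, and the universal property makes the lift an S-linear
    section. *)
Lemma very_flat_base_change (F : lmodType R) (T : lmodType S) (j : F -> T) :
  IsBaseChange phi j -> very_flat F -> very_flat T.
Proof.
move=> [jL jU] vF C /contraadjustedP cC E f g fL gL fI gS fgE.
have cC' : ca (restr phi C).
  by move=> a c; have [x xE] := cC (phi a) c; exists x.
have fg : @ses R (restr phi C) (restr phi E) (restr phi T) f g.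
  by split=> // r x y; [apply: (fL (phi r)) | apply: (gL (phi r))].
have [h [hL hE]] := Ext1_lift (vF _ (ca_contraadjusted cC')) fg (jL : Lin (j : F -> restr phi T)).
have [s [sL sE _]] := jU E h hL; exists s; split=> // l.
have [i [iL iE iU]] := jU T j jL; transitivity (i l); last by apply/esym/(iU id).
apply: (iU (g \o s)); first exact: Lin_comp.
by move=> x /=; rewrite sE hE.
Qed.

End BaseChange.

(** * Quotients by primes and the Nullstellensatz *)

Section ClassicalDomain.
Variable B : comNzRingType.
Hypothesis B_domain : forall x y : B, x * y = 0 -> x = 0 \/ y = 0.
(** Excluded middle and choice supply the unit predicate and the inverse demanded by
    [idomainType]. *)
Definition classical_domain : Type := B.
HB.instance Definition _ := GRing.ComNzRing.on classical_domain.
Let unit : pred classical_domain := fun x => `[< exists y, y * x = 1 >].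
Let inv (x : classical_domain) : classical_domain :=
  if pselect (exists y, y * x = 1) is left e then sval (cid e) else x.
Let mulVx : {in unit, left_inverse 1 inv *%R}.
Proof.
by move=> x /asboolP ux; rewrite /inv; case: pselect => // e; case: cid.
Qed.
Let unitPl x y : y * x = 1 -> unit x.
Proof. by move=> yx; apply/asboolP; exists y. Qed.
Let inv_out : {in [predC unit], inv =1 id}.
Proof. by move=> x /asboolP ux; rewrite /inv; case: pselect. Qed.
HB.instance Definition _ :=
  GRing.ComNzRing_hasMulInverse.Build classical_domain mulVx unitPl inv_out.
Let dom (x y : classical_domain) : x * y = 0 -> (x == 0) || (y == 0).
Proof. by move=> /B_domain[->|->]; rewrite eqxx ?orbT. Qed.
HB.instance Definition _ := GRing.ComUnitRing_isIntegral.Build classical_domain dom.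
Definition idomain_of : idomainType := classical_domain.
End ClassicalDomain.

Section PrimeQuotient.
Variables (B : comNzRingType) (p : B -> Prop).
Hypothesis pP : is_prime_ideal p.
Let I : {pred B} := fun x => `[< p x >].
Let I_ideal : idealr_closed I.
Proof.
case: pP => [[p0 pD pM] p1 _]; split; [exact/asboolP | exact/asboolP |].
by move=> a x y /asboolP px /asboolP py; apply/asboolP; apply: pD => //; apply: pM.
Qed.
Let I_prime : prime_idealr_closed I.
Proof.
case: pP => _ _ pM x y /asboolP /pM[px|py]; apply/orP; [left|right]; exact/asboolP.
Qed.
Definition prime_pred of is_prime_ideal p : {pred B} := I.
Local Notation P := (prime_pred pP).
HB.instance Definition _ := isIdealr.Build B P I_ideal.
HB.instance Definition _ := isPrimeIdealrClosed.Build B P I_prime.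

Lemma prime_quotient_nz : exists (D : idomainType) (pi : {rmorphism B -> D}),
  onto pi /\ forall x, pi x = 0 <-> p x.
Proof.
pose Q := {ideal_quot P}; pose pi : {rmorphism B -> Q} := \pi_Q%qT.
have dom (x y : Q) : x * y = 0 -> x = 0 \/ y = 0.
  by move=> /Quotient.rquot_IdomainAxiom/orP[]/eqP; [left|right].
have piS : onto pi by move=> y; exists (repr y); apply: reprK.
have piE x : pi x = 0 <-> p x.
  have -> : (pi x = 0) = (x \in P).
    apply/propext; rewrite -[x in x \in _]subr0 Quotient.idealrBE -(rmorph0 pi).
    by split=> [e|/eqP //]; apply/eqP.
  by split=> /asboolP.
by exists (idomain_of dom), pi.
Qed.
End PrimeQuotient.

Lemma prime_quotient (A : comPzRingType) (p : A -> Prop) : is_prime_ideal p ->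
  exists (D : idomainType) (pi : {rmorphism A -> D}), onto pi /\ forall x, pi x = 0 <-> p x.
Proof.
move=> pP; have [|B BE] := @comNzRing_of A; last by subst A; apply: prime_quotient_nz.
by case: pP => [[p0 _ _] p1 _] e; apply: p1; rewrite e.
Qed.

(** * Zariski's lemma over a domain, phrased without fraction fields *)

Definition generated (A D : pzRingType) (f : A -> D) (s : seq D) (y : D) :=
  forall P : D -> Prop, (forall r, P (f r)) -> (forall g, g \in s -> P g) ->
    (forall u v, P u -> P v -> P (u + v)) -> (forall u v, P u -> P v -> P (u * v)) -> P y.

Definition algebraic (A D : nzRingType) (f : A -> D) (x : D) :=
  exists2 q : {poly A}, q != 0 & root (map_poly f q) x.

Lemma horner_map_wide (A D : nzRingType) (f : {rmorphism A -> D}) (q : {poly A}) n x :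
  (size q <= n)%N -> (map_poly f q).[x] = \sum_(i < n) f q`_i * x ^+ i.
Proof.
move=> qn; rewrite (@horner_coef_wide _ n); last exact: leq_trans (size_poly _ _) qn.
by apply: eq_bigr => i _; rewrite coef_map.
Qed.

(** For the leading coefficient a and the degree n > 0, a^(n-1) q(z) is a monic polynomial in a z;
    for n = 0 the equation reads f a = 0. *)
Lemma algebraic_integral (A : idomainType) (D : comNzRingType) (f : {rmorphism A -> D}) z :
  algebraic f z -> exists2 a, a != 0 & integralOver f (f a * z).
Proof.
move=> [q q0 /rootP qz]; set a := lead_coef q.
exists a; first by rewrite lead_coef_eq0.
have szq : size q = (size q).-1.+1 by rewrite prednK // size_poly_gt0.
set n := (size q).-1 in szq; case: (posnP n) => [n0|n_gt0].
  have qC : q = a%:P by rewrite /a lead_coefE -/n n0; apply: size1_polyC; rewrite szq n0.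
  move: qz; rewrite qC map_polyC hornerC => /= ->; rewrite mul0r; exact: integral0.
pose t := \poly_(i < n) (q`_i * a ^+ (n.-1 - i)).
have tn : (size t < size ('X^n : {poly A}))%N by rewrite size_polyXn ltnS size_poly.
exists ('X^n + t); first by rewrite monicE lead_coefDl ?lead_coefXn.
apply/rootP; rewrite rmorphD /= map_polyXn hornerD hornerXn.
rewrite (@horner_map_wide _ _ f t n) ?size_poly //.
have -> : \sum_(i < n) f t`_i * (f a * z) ^+ i = f a ^+ n.-1 * \sum_(i < n) f q`_i * z ^+ i.
  rewrite mulr_sumr; apply: eq_bigr => i _; rewrite coef_poly ltn_ord rmorphM rmorphXn /=.
  have ein : n.-1 = (n.-1 - i + i)%N by rewrite subnK // -ltnS prednK.
  by rewrite exprMn [in RHS]ein exprD; ring.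
rewrite exprMn -[in f a ^+ n](prednK n_gt0) exprSr -mulrA -mulrDr.
move: qz; rewrite (@horner_map_wide _ _ f q n.+1) ?szq // big_ord_recr /= -/n addrC.
by rewrite {1}/n -lead_coefE -/a => ->; rewrite mulr0.
Qed.

(** A monic equation of degree d for w = v / g, multiplied by g^d, expresses v^d as a multiple of
    g. *)
Lemma integral_fraction (A D : comNzRingType) (f : {rmorphism A -> D}) g v w :
  injective f -> integralOver f w -> f g * w = f v -> exists d h, v ^+ d = g * h.
Proof.
move=> fI [q qm /rootP qw] gw.
have szq : size q = (size q).-1.+1 by rewrite prednK // size_poly_gt0 monic_neq0.
set d := (size q).-1 in szq.
exists d, (- \sum_(i < d) q`_i * g ^+ (d - i.+1) * v ^+ i); apply: fI.
move: qw; rewrite (@horner_map_wide _ _ f q d.+1) ?szq // big_ord_recr /=.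
have -> : q`_d = 1 by rewrite -(monicP qm) lead_coefE.
rewrite rmorph1 mul1r => /(congr1 (fun x => f g ^+ d * x)); rewrite mulr0 mulrDr.
rewrite -exprMn gw addrC => /eqP; rewrite addr_eq0 [f (v ^+ d)]rmorphXn => /eqP ->.
rewrite mulrN rmorphN !mulr_sumr rmorph_sum /=; congr (- _); apply: eq_bigr => i _.
rewrite !rmorphM !rmorphXn /= -gw exprMn.
have -> : f g ^+ d = f g * f g ^+ (d - i.+1) * f g ^+ i.
  by rewrite -exprS subnSK // -exprD subnK // ltnW.
ring.
Qed.

Lemma algebraic_common_denominator (A : idomainType) (D : comNzRingType)
    (f : {rmorphism A -> D}) (zs : seq D) :
  (forall z, z \in zs -> algebraic f z) -> (forall y, generated f zs y) ->
  exists2 a, a != 0 & forall y, exists N, integralOver f (f a ^+ N * y).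
Proof.
move=> alg gen.
have [a a0 aP] : exists2 a, a != 0 & forall z, z \in zs -> integralOver f (f a * z).
  elim: zs alg {gen} => [|z zs IH] alg; first by exists 1; rewrite ?oner_eq0.
  have [|a a0 aP] := IH; first by move=> y yz; apply: alg; rewrite inE yz orbT.
  have [|b b0 bP] := @algebraic_integral _ _ f z; first by apply: alg; rewrite mem_head.
  exists (a * b); rewrite ?mulf_neq0 // => y; rewrite inE rmorphM => /predU1P[->|/aP ya].
    by rewrite -mulrA; apply: integral_mul => //; apply: integral_id.
  by rewrite mulrAC [_ * f b]mulrC; apply: integral_mul => //; apply: integral_id.
have intX n : integralOver f (f a ^+ n) by rewrite -rmorphXn; apply: integral_id.
exists a => // y;
  apply: (gen y (fun y => exists N, integralOver f (f a ^+ N * y))) => [r|z zz|u v [m um] [n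
    vn]|u v [m um] [n vn]].
- by exists 0%N; rewrite mul1r; apply: integral_id.
- by exists 1%N; rewrite expr1; apply: aP.
- exists (m + n)%N; rewrite exprD mulrDr; apply: integral_add.
    by rewrite mulrAC [_ * f a ^+ n]mulrC; apply: integral_mul.
  by rewrite -mulrA; apply: integral_mul.
- by exists (m + n)%N; rewrite exprD mulrACA; apply: integral_mul.
Qed.

(* 1 + X a is not a unit of A[X][1/a], even after inverting the nonzero constants. *)
Lemma no_transcendental (A : idomainType) (D : comNzRingType)
    (f : {rmorphism {poly A} -> D}) (zs : seq D) :
  injective f -> (forall y, y <> 0 -> exists t u, u <> 0 /\ y * t = f u%:P) ->
  (forall z, z \in zs -> algebraic f z) -> (forall y, generated f zs y) -> False.
Proof.
move=> fI inv alg gen; have [a a0 aP] := algebraic_common_denominator alg gen.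
pose g : {poly A} := 1 + 'X * a.
have szX : size ('X * a) = (size a).+1 by rewrite mulrC size_mulX.
have sza : (0 < size a)%N by rewrite size_poly_gt0.
have szg : size g = (size a).+1 by rewrite /g addrC size_polyDl szX // size_poly1 ltnS.
have g0 : g != 0 by rewrite -size_poly_gt0 szg.
have fg0 : f g <> 0 by rewrite -(rmorph0 f) => /fI/eqP; rewrite (negPf g0).
have [t [u [u0 tu]]] := inv _ fg0.
have [N Nt] := aP t.
have [|d [h hE]] := @integral_fraction _ _ f g (a ^+ N * u%:P) _ fI Nt.
  by rewrite mulrCA tu rmorphM rmorphXn.
(* So far g divides (a^N u)^d. As X a = -1 modulo g, multiplying by X^(N d) removes the powers of a,
   and g divides a nonzero constant, against its positive degree. *)
have gdvd : exists h', ((-1) ^+ N * u%:P) ^+ d = g * h'.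
  have [k kE] : exists k, (-1) ^+ N = ('X * a) ^+ N + g * k.
    exists (- \sum_(i < N) ('X * a) ^+ (N.-1 - i) * (-1) ^+ i).
    rewrite (_ : g = 'X * a - -1); last by rewrite opprK addrC.
    by rewrite mulrN -subrXX opprB addrC subrK.
  have -> : ((-1) ^+ N * u%:P) ^+ d = (('X * a) ^+ N * u%:P + g * (k * u%:P)) ^+ d.
    by rewrite kE mulrDl mulrA.
  have step (x y : {poly A}) : exists z, (x + g * y) ^+ d = x ^+ d + g * z.
    elim: d {hE} => [|d [z zE]]; first by exists 0; rewrite mulr0 addr0.
    exists (x ^+ d * y + z * (x + g * y)); rewrite exprSr zE [x ^+ d.+1]exprSr; ring.
  have [z ->] := step (('X * a) ^+ N * u%:P) (k * u%:P).
  exists ('X ^+ (N * d) * h + z); rewrite mulrDr; congr (_ + _).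
  by rewrite [RHS]mulrCA -hE exprM -exprMn mulrA -exprMn.
case: gdvd => h' /(congr1 (fun q : {poly A} => size q)).
have -> : ((-1) ^+ N * u%:P) ^+ d = (((-1) ^+ N * u) ^+ d)%:P :> {poly A}.
  by rewrite !(rmorphXn, rmorphM, rmorphN, rmorph1).
have c0 : ((-1) ^+ N * u) ^+ d != 0.
  by rewrite expf_neq0 // mulf_neq0 ?expf_neq0 ?oppr_eq0 ?oner_eq0 //; apply/eqP.
rewrite size_polyC c0 => e.
have h'0 : h' != 0 by apply/eqP => h'0; move: e; rewrite h'0 mulr0 size_poly0.
move: e; rewrite size_mul // szg; have := h'0; rewrite -size_poly_gt0.
by case: (size h') => // m _; rewrite addSn addnS /= => -[]; case: (size a) sza.
Qed.

(** The second hypothesis says that inverting the nonzero elements of A turns D into a field. The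
    induction on [xs] lets A vary: an algebraic generator moves to [ys], and a transcendental one
    enlarges A to A[X], over which the others are algebraic by induction, against
    [no_transcendental]. *)
Lemma zariski_lemma (D : comNzRingType) (xs : seq D) :
  forall (A : idomainType) (f : {rmorphism A -> D}) (ys : seq D),
  injective f -> (forall y, y <> 0 -> exists t u, u <> 0 /\ y * t = f u) ->
  (forall y, generated f (xs ++ ys) y) -> (forall y, y \in ys -> algebraic f y) ->
  forall x, x \in xs -> algebraic f x.
Proof.
elim: xs => [//|x xs IH] A f ys fI inv gen alg.
have [ax|nax] := EM (algebraic f x).
  move=> z; rewrite inE => /predU1P[-> //|]; apply: (IH A f (x :: ys)) => //.
    move=> y P P1 P2 P3 P4; apply: (gen y) => // g gi; apply: P2.
    by move: gi; rewrite /= !(inE, mem_cat) orbCA.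
  by move=> y; rewrite inE => /predU1P[->|/alg].
exfalso.
have cf : commr_rmorph f x by move=> r; apply: mulrC.
pose f' : {rmorphism {poly A} -> D} := horner_morph cf.
have f'C r : f' r%:P = f r by apply: horner_morphC.
have f'I : injective f'.
  move=> p q e; apply: contrapT => pq; apply: nax; exists (p - q).
    by rewrite subr_eq0; apply/eqP.
  apply/rootP; rewrite rmorphB hornerD hornerN; apply/eqP; rewrite subr_eq0; apply/eqP; exact: e.
have inv' y : y <> 0 -> exists t u, u <> 0 /\ y * t = f' u%:P.
  by move=> /inv[t [u [u0 tu]]]; exists t, u; rewrite f'C.
have alg' y : algebraic f y -> algebraic f' y.
  move=> [q q0 qy]; exists q^:P; first by rewrite map_polyC_eq0.
  rewrite -map_poly_comp (_ : map_poly _ q = map_poly f q) //.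
  by apply: eq_map_poly => r /=; rewrite f'C.
have gen' y : generated f' (xs ++ ys) y.
  move=> P P1 P2 P3 P4; apply: (gen y) => // [r|g]; first by rewrite -f'C.
  rewrite /= inE => /predU1P[->|]; last exact: P2.
  by have := P1 'X; rewrite [f' _]horner_morphX.
apply: (no_transcendental f'I inv' _ gen') => z; rewrite mem_cat => /orP[zx|/alg/alg' //].
apply: (IH _ f' ys) => //.
- move=> y /inv'[t [u [u0 tu]]]; exists t, u%:P; split=> // /eqP.
  by rewrite polyC_eq0 => /eqP.
- by move=> y /alg/alg'.
Qed.

Section GenericBasis.
Variables (A : idomainType) (D : comNzRingType) (f : {rmorphism A -> D}).
Hypothesis fI : injective f.
Implicit Types (E : seq D).

Inductive lin_span E : D -> Prop :=
| lin_span0 : lin_span E 0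
| lin_spanS r e z : e \in E -> lin_span E z -> lin_span E (f r * e + z).

Lemma lin_spanD E y z : lin_span E y -> lin_span E z -> lin_span E (y + z).
Proof.
by move=> Ey Ez; elim: Ey => [|r e y' eE _ IH]; rewrite ?add0r // -addrA; apply: lin_spanS.
Qed.

Lemma lin_spanZ E r y : lin_span E y -> lin_span E (f r * y).
Proof.
elim=> [|s e z eE _ IH]; first by rewrite mulr0; apply: lin_span0.
by rewrite mulrDr mulrA -rmorphM; apply: lin_spanS.
Qed.

Lemma lin_span_mem E e : e \in E -> lin_span E e.
Proof.
move=> eE; rewrite -[e]addr0 -[e]mul1r -(rmorph1 f); apply: lin_spanS => //; exact: lin_span0.
Qed.

Lemma lin_span_sum E n (F : 'I_n -> D) : (forall i, lin_span E (F i)) -> lin_span E (\sum_i F i).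
Proof. by move=> FE; apply: big_ind => //; [apply: lin_span0 | apply: lin_spanD]. Qed.

(* The span of E over the fraction field of A, without leaving D. *)
Definition frac_span E y := exists2 u, u != 0 & lin_span E (f u * y).

Lemma lin_frac_span E y : lin_span E y -> frac_span E y.
Proof. by exists 1; rewrite ?oner_eq0 // rmorph1 mul1r. Qed.

Lemma frac_spanM E E' y z : (forall e, e \in E -> frac_span E' (y * e)) ->
  frac_span E z -> frac_span E' (y * z).
Proof.
move=> yE [u u0 uz].
have {uz} [v v0 vz] : frac_span E' (y * (f u * z)).
  elim: uz => [|r e w /yE[v v0 ve] _ [v' v'0 vw]].
    by rewrite mulr0; apply/lin_frac_span/lin_span0.
  exists (v * v'); rewrite ?mulf_neq0 // rmorphM mulrDr mulrDr; apply: lin_spanD.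
    have -> : f v * f v' * (y * (f r * e)) = f v' * (f r * (f v * (y * e))) by ring.
    by do 2!apply: lin_spanZ.
  by rewrite -mulrA; apply: lin_spanZ.
exists (v * u); first by rewrite mulf_neq0.
by rewrite rmorphM; have -> : f v * f u * (y * z) = f v * (y * (f u * z)) by ring.
Qed.

Lemma frac_span_trans E E' z : (forall e, e \in E -> frac_span E' e) ->
  frac_span E z -> frac_span E' z.
Proof.
by move=> EE Ez; rewrite -[z]mul1r; apply: frac_spanM Ez => e /EE; rewrite mul1r.
Qed.

(** E consists of monomials in which each generator has exponent below the degree of its equation;
    only the top power needs a denominator, the leading coefficient. *)
Lemma algebraic_finite (xs : seq D) : (forall x, x \in xs -> algebraic f x) ->
  exists E, 1 \in E /\ forall x, x \in xs -> forall e, e \in E -> frac_span E (x * e).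
Proof.
elim: xs => [|x xs IH] alg; first by exists [:: 1]; rewrite mem_head.
have [|E [E1 EP]] := IH; first by move=> y yxs; apply: alg; rewrite inE yxs orbT.
have [q q0 /rootP qx] := alg x (mem_head _ _).
have szq : size q = (size q).-1.+1 by rewrite prednK // size_poly_gt0.
set d := (size q).-1 in szq.
have lq0 : q`_d != 0 by rewrite -lead_coefE lead_coef_eq0.
have qE : f q`_d * x ^+ d = - \sum_(i < d) f q`_i * x ^+ i.
  move: qx; rewrite (@horner_map_wide _ _ f q d.+1) ?szq // big_ord_recr /= => /eqP.
  by rewrite addrC addr_eq0 => /eqP.
have d0 : (0 < d)%N.
  rewrite lt0n; apply/eqP => d0; move: qE;
    rewrite d0 big_ord0 oppr0 expr0 mulr1 -(rmorph0 f) => /fI/eqP.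
  by move: lq0; rewrite d0 => /negPf ->.
pose E' := [seq x ^+ i * e | i <- iota 0 d, e <- E].
have mE' i e : (i < d)%N -> e \in E -> x ^+ i * e \in E'.
  by move=> id eE; apply/allpairsP; exists (i, e); rewrite mem_iota.
have E'P z : z \in E' -> exists i e, [/\ (i < d)%N, e \in E & z = x ^+ i * e].
  by move=> /allpairsP[[i e] /= [iI eE ->]]; exists i, e; rewrite mem_iota in iI.
exists E'; split; first by rewrite -[1](mulr1 (x ^+ 0)); apply: mE'.
move=> y; rewrite inE => /predU1P[->|yxs] z /E'P[i [e [id eE ->]]]; last first.
  rewrite mulrCA; apply: frac_spanM (EP _ yxs _ eE) => e' e'E.
  by apply/lin_frac_span/lin_span_mem/mE'.
rewrite mulrA -exprS; have [id'|] := ltnP i.+1 d.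
  by apply/lin_frac_span/lin_span_mem/mE'.
move=> di; have -> : i.+1 = d by apply/eqP; rewrite eqn_leq id di.
exists q`_d => //; rewrite mulrA qE mulNr -mulN1r -(rmorph1 f) -rmorphN; apply: lin_spanZ.
rewrite mulr_suml; apply: lin_span_sum => j; rewrite -mulrA; apply: lin_spanZ.
by apply/lin_span_mem/mE'.
Qed.

(** Greedy choice: e is kept unless it lies in the fraction-field span of the elements kept so far;
    a relation with nonzero coefficient at e would put it there. *)
Lemma independent_sub E : exists E', [/\ {subset E' <= E}, uniq E',
  forall a : D -> A, \sum_(e <- E') f (a e) * e = 0 -> forall e, e \in E' -> a e = 0 &
  forall e, e \in E -> frac_span E' e].
Proof.
elim: E => [|e E [E' [sE' uE' iE' EE']]]; first by exists [::]; split.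
have [eE'|neE'] := EM (frac_span E' e).
  exists E'; split=> // [x /sE'|x]; first by rewrite inE orbC => ->.
  by rewrite inE => /predU1P[->|/EE'].
have eN : e \notin E' by apply/negP => /lin_span_mem/lin_frac_span.
exists (e :: E'); split=> [x||a|x].
- by rewrite !inE => /orP[->|/sE' ->] //; rewrite orbT.
- by rewrite /= eN.
- rewrite big_cons => ae; have ae0 : a e = 0.
    apply/eqP; apply: contrapT => /negP ne0; apply: neE'; exists (a e) => //.
    move: ae => /eqP; rewrite addr_eq0 => /eqP ->.
    rewrite -mulN1r -(rmorph1 f) -rmorphN; apply: lin_spanZ.
    rewrite big_seq; apply: big_ind => [||x xE']; [exact: lin_span0 | exact: lin_spanD |].
    by apply/lin_spanZ/lin_span_mem.
  move: ae; rewrite ae0 rmorph0 mul0r add0r => /iE' H x.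
  by rewrite inE => /predU1P[-> //|/H].
- rewrite inE => /predU1P[->|/EE']; first by apply/lin_frac_span/lin_span_mem/mem_head.
  apply: frac_span_trans => y yE'; apply/lin_frac_span/lin_span_mem.
  by rewrite inE yE' orbT.
Qed.

Lemma generic_basis (xs : seq D) : (forall y, generated f xs y) ->
  (forall x, x \in xs -> algebraic f x) ->
  exists n (e : 'I_n.+1 -> D) c, [/\ c != 0,
    forall r : 'I_n.+1 -> A, \sum_i f (r i) * e i = 0 -> forall i, r i = 0 &
    forall s, exists k (M : 'M[A]_n.+1), forall i, f c ^+ k * s * e i = \sum_j f (M i j) * e j].
Proof.
move=> gen alg; have [E [E1 EP]] := algebraic_finite alg.
have [E' [sE' uE' iE' EE']] := independent_sub E.
have xE' x e : x \in xs -> e \in E' -> frac_span E' (x * e).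
  by move=> xxs /sE' eE; apply: frac_span_trans EE' _; apply: EP.
(* The span contains 1 up to a nonzero factor, so the basis is not empty; matrices of size [n.+1]
   form a ring. *)
have [n szE'] : exists n, size E' = n.+1.
  case Es: E' => [|y s]; last by exists (size s).
  have [u /eqP u0] := EE' 1 E1; rewrite mulr1 Es => H; case: u0.
  by apply: fI; rewrite rmorph0; case: H.
pose e (i : 'I_n.+1) := E'`_i.
have eE i : e i \in E' by apply: mem_nth; rewrite szE'.
have Ee y : y \in E' -> exists i, y = e i.
  move=> yE'; have iy : (index y E' < n.+1)%N by rewrite -szE' index_mem.
  by exists (Ordinal iy); rewrite /e /= nth_index.
have spanE y : lin_span E' y -> exists a : 'I_n.+1 -> A, y = \sum_i f (a i) * e i.
  elim=> [|r z w /Ee[i ->] _ [a ->]].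
    by exists (fun=> 0); rewrite big1 // => i _; rewrite rmorph0 mul0r.
  exists (fun j => (if j == i then r else 0) + a j).
  under [RHS]eq_bigr => j _ do rewrite rmorphD mulrDl.
  rewrite big_split /=; congr (_ + _); rewrite (bigD1 i) //= eqxx big1 ?addr0 // => j /negPf ->.
  by rewrite rmorph0 mul0r.
(* One c clears the denominators for all generators at once; a product of generators then costs a
   power of c, whence the exponent k depending on s. *)
have [c c0 cP] : exists2 c, c != 0 & forall x, x \in xs -> forall i, lin_span E' (f c * (x * e i)).
  elim: xs xE' {gen alg EP} => [|x xs IH] xE'; first by exists 1; rewrite ?oner_eq0.
  have [|c c0 cP] := IH; first by move=> y z yxs; apply: xE'; rewrite inE yxs orbT.
  have /choice[u uP] i : exists u, u != 0 /\ lin_span E' (f u * (x * e i)).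
    by have [u u0 uP] := xE' x (e i) (mem_head _ _) (eE i); exists u.
  exists (c * \prod_i u i).
    by rewrite mulf_neq0 //; apply/prodf_neq0 => i _; have [] := uP i.
  move=> y; rewrite inE => /predU1P[->|yxs] i; last first.
    by rewrite [c * _]mulrC rmorphM -mulrA; apply/lin_spanZ/cP.
  rewrite (bigD1 i) //= [c * _]mulrCA [u i * _]mulrC rmorphM -mulrA; apply: lin_spanZ.
  by have [] := uP i.
exists n, e, c; split=> // [r r0 i|s].
  pose a y := if [pick i | y == e i] is Some i then r i else 0.
  have eI : injective e.
    by move=> j k /eqP; rewrite /e nth_uniq ?szE' // => /eqP/val_inj.
  have ae j : a (e j) = r j.
    by rewrite /a; case: pickP => [k /eqP/eI -> //|/(_ j)]; rewrite eqxx.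
  rewrite -ae; apply: iE' (eE i); rewrite (big_nth 0) szE' big_mkord.
  by rewrite -[RHS]r0; apply: eq_bigr => j _; rewrite -/(e j) ae.
apply: (gen s (fun s => exists k (M : 'M[A]_n.+1),
   forall i, f c ^+ k * s * e i = \sum_j f (M i j) * e j)).
- move=> r; exists 0%N, r%:M => i;
  rewrite expr0 mul1r (bigD1 i) //= mxE eqxx big1 ?addr0 // => j ji.
  by rewrite mxE eq_sym (negPf ji) rmorph0 mul0r.
- move=> x xxs;
  have /choice[a aE] i : exists a : 'I_n.+1 -> A, f c * (x * e i) = \sum_j f (a j) * e j.
    exact/spanE/cP.
  exists 1%N, (\matrix_(i, j) a i j) => i; rewrite expr1 -mulrA aE.
  by apply: eq_bigr => j _; rewrite mxE.
- move=> s1 s2 [k1 [M1 E1']] [k2 [M2 E2']];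
  exists (k1 + k2)%N, (c ^+ k2 *: M1 + c ^+ k1 *: M2) => i.
  have -> : f c ^+ (k1 + k2) * (s1 + s2) * e i =
     f c ^+ k2 * (f c ^+ k1 * s1 * e i) + f c ^+ k1 * (f c ^+ k2 * s2 * e i) by rewrite exprD; ring.
  rewrite E1' E2' !mulr_sumr -big_split; apply: eq_bigr => j _.
  by rewrite !mxE rmorphD !rmorphM !rmorphXn /= mulrDl !mulrA.
- move=> s1 s2 [k1 [M1 E1']] [k2 [M2 E2']]; exists (k1 + k2)%N, (M1 * M2) => i.
  have -> : f c ^+ (k1 + k2) * (s1 * s2) * e i = f c ^+ k2 * s2 * (f c ^+ k1 * s1 * e i).
    by rewrite exprD; ring.
  rewrite E1' mulr_sumr; under eq_bigr => j _ do rewrite mulrCA E2' mulr_sumr.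
  rewrite exchange_big; apply: eq_bigr => l _.
  rewrite mxE rmorph_sum mulr_suml; apply: eq_bigr => j _.
  by rewrite rmorphM mulrA.
Qed.

End GenericBasis.

Section MaximalPrime.
Variables (R S : comPzRingType) (phi : {rmorphism R -> S}) (p : R -> Prop).
Hypothesis pP : is_prime_ideal p.

(** The third clause makes S/q a field after inverting R/p minus 0. It comes from maximality: for s
    outside q, the ideal q + (s) contracts to more than p. It also yields primality, since two
    elements outside q have a product dividing some phi (u v) modulo q, with u v outside p. *)
Lemma maximal_prime_over : (exists q : S -> Prop, is_prime_ideal q /\ forall r, p r <-> q (phi
  r)) ->
  exists q : S -> Prop, [/\ is_prime_ideal q, forall r, p r <-> q (phi r) &
    forall s, ~ q s -> exists t u, ~ p u /\ q (s * t - phi u)].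
Proof.
move=> [q0 [q0P q0E]].
pose over (X : S -> Prop) := is_ideal X /\ forall r, p r <-> X (phi r).
pose P (X : S -> Prop) := (forall x, ~ X x) \/ over X.
have [|q [Pq qmax]] := @classical_sets.Zorn_bigcup S P.
  move=> F FP Ftot; have [allE|] := EM (forall X, F X -> forall x, ~ X x).
    by left=> x [X FX Xx]; apply: (allE X FX x).
  move=> /existsNP[X0 /not_implyP[FX0 /existsNP[x0 /contrapT X0x0]]]; right.
  have ov X x : F X -> X x -> over X by move=> FX Xx; case: (FP X FX) => // /(_ x).
  have ovX0 := ov _ _ FX0 X0x0.
  split; last first.
    move=> r; split=> [pr|[X FX Xr]]; first by exists X0 => //; apply/(proj2 ovX0).
    by apply/(proj2 (ov _ _ FX Xr)).
  split; first by exists X0 => //; case: ovX0 => [[]].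
    move=> x y [X FX Xx] [Y FY Yy]; have [XY|YX] := Ftot X Y FX FY.
      by exists Y => //; have [[_ D _] _] := ov _ _ FY Yy; apply: D => //; apply: XY.
    by exists X => //; have [[_ D _] _] := ov _ _ FX Xx; apply: D => //; apply: YX.
  by move=> r x [X FX Xx]; exists X => //; have [[_ _ M] _] := ov _ _ FX Xx; apply: M.
have q0ov : over q0 by case: q0P.
case: Pq => [qE|[qid qE]].
  case: (qmax q0); last by right.
  split=> [x /qE //|]; apply: contrapT => H; apply: (qE 0); apply: contrapT => _.
  by apply: H => /(_ 0); case: q0ov => [[z _ _] _] /(_ z)/qE.
have star s : ~ q s -> exists t u, ~ p u /\ q (s * t - phi u).
  move=> nqs; have nP : ~ P (adjoin q s).
    apply: qmax; split; first by move=> x; apply: sub_adjoin.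
    by move=> H; apply: nqs; apply: H; apply: mem_adjoin.
  apply: contrapT => H; apply: nP; right; split; first exact: adjoin_ideal.
  move=> r; split=> [/qE|[x [t [qx rE]]]]; first exact: sub_adjoin.
  apply: contrapT => npr; apply: H; exists t, r; split=> //.
  rewrite rE opprD addrCA mulrC subrr addr0; case: qid => _ _ M.
  by rewrite -mulN1r; apply: M.
have [pid p1 pM] := pP; have [_ qD qM] := qid.
exists q; split=> //; split=> // [q1|s t st]; first by apply: p1; apply/qE; rewrite rmorph1.
apply: contrapT => H.
have [|s' [u [npu su]]] := star s; first by move=> qs; apply: H; left.
have [|t' [v [npv tv]]] := star t; first by move=> qt; apply: H; right.
suff /qE/pM[/npu|/npv] : q (phi (u * v)) by [].
rewrite rmorphM; have -> : phi u * phi v = s' * t' * (s * t) +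
    (- (t * t') * (s * s' - phi u) + - phi u * (t * t' - phi v)).
  by ring.
by apply: (qD); [|apply: qD]; apply: qM.
Qed.

End MaximalPrime.

(** * Descent *)

Section ExtMore.
Variable A : comPzRingType.

Lemma Ext1_zero (F C : lmodType A) : (forall x : C, x = 0) -> Ext1_vanishes F C.
Proof.
move=> C0; have [G [K [k [p [Gp kp]]]]] := projective_presentation F.
apply: (hom_Ext1 Gp kp) => h _; exists (fun=> 0); split=> [|x]; first exact: Lin_0.
by rewrite (C0 (h x)).
Qed.

Lemma Ext1_retract (F C X : lmodType A) (i : C -> X) (r : X -> C) : Lin i -> Lin r ->
  (forall x, r (i x) = x) -> Ext1_vanishes F X -> Ext1_vanishes F C.
Proof.
move=> iL rL ri VX; have [G [K [k [p [Gp kp]]]]] := projective_presentation F.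
apply: (hom_Ext1 Gp kp) => h hL; have [g [gL gE]] := Ext1_hom VX kp (Lin_comp hL iL).
exists (r \o g); split=> [|x]; first exact: Lin_comp.
by rewrite /= gE /= ri.
Qed.

Lemma separated_eq0 c (D : lmodType A) (w : nat -> D) :
  (forall x : D, (forall n, exists y, x = c ^+ n *: y) -> x = 0) ->
  (forall n, w n = c *: w n.+1) -> forall n, w n = 0.
Proof.
move=> sep wE n; apply: sep => m; exists (w (n + m)%N).
elim: m => [|m ->]; first by rewrite addn0 expr0 scale1r.
by rewrite wE scalerA addnS exprSr.
Qed.

(* A homomorphism into D is lifted by successive approximation modulo powers of c. *)
Lemma Ext1_complete (F : lmodType A) (c : A) (D D' : lmodType A) (g : D -> D') :
  Lin g -> onto g -> (forall x, g x = 0 <-> exists y, x = c *: y) ->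
  regular c D -> (forall x : D, (forall n, exists y, x = c ^+ n *: y) -> x = 0) ->
  ca D -> Ext1_vanishes F D' -> Ext1_vanishes F D.
Proof.
move=> gL gS gE rD sep cD V; have [G [K [k [p [Gp kp]]]]] := projective_presentation F.
apply: (hom_Ext1 Gp kp) => h0 h0L; case: (kp) => kL _ _ _ _.
have cL : Lin (fun x : D => c *: x) by move=> r x y; rewrite scalerDr !scalerA mulrC.
pose Hom := {h : K -> D | Lin h}.
have /choice[st stP] (h : Hom) : exists gh : (G -> D) * Hom, Lin gh.1 /\
    forall x, sval h x = gh.1 (k x) + c *: sval gh.2 x.
  case: h => h hL /=; have [g1 [g1L g1E]] := Ext1_hom V kp (Lin_comp hL gL).
  have [g2 [g2L g2E]] := Gp _ _ g g1 gL gS g1L.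
  have [|h' [h'L h'E]] := lift_through cL (regular_inj rD) (Lin_sub hL (Lin_comp kL g2L)).
    move=> x; have /gE[y yE] : g (h x - g2 (k x)) = 0 by rewrite (LinB gL) g2E g1E subrr.
    by exists y; rewrite yE.
  exists (g2, exist _ h' h'L); split=> // x /=.
  by rewrite h'E addrC subrK.
pose H n := iter n (fun h => (st h).2) (exist _ h0 h0L : Hom).
pose a n := (st (H n)).1.
have aL n : Lin (a n) by case: (stP (H n)).
have HE n x : sval (H n) x = a n (k x) + c *: sval (H n.+1) x by case: (stP (H n)).
(* The sum of the c^n a_n(y) is chosen separately for each y; linearity is recovered from the
   uniqueness of such sums in a separated module. *)
have /choice[Y YE] y : exists Y : nat -> D, forall n, Y n = a n y + c *: Y n.+1 by apply: cD.
exists (fun y => Y y 0%N); split=> [r x y|x]; apply: subr0_eq.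
  pose w n := Y (r *: x + y) n - (r *: Y x n + Y y n).
  apply: (separated_eq0 (w := w) sep) => n; rewrite /w (YE (r *: x + y) n) (YE x n) (YE y n) aL.
  rewrite scalerBr scalerDr !scalerDr opprD.
  have -> : r *: (c *: Y x n.+1) = c *: (r *: Y x n.+1) by rewrite !scalerA mulrC.
  by rewrite -opprD (addrACA (r *: a n x)) opprD addrACA subrr add0r.
pose w n := Y (k x) n - sval (H n) x.
apply: (separated_eq0 (w := w) sep) => n.
by rewrite /w (YE (k x) n) (HE n) opprD addrACA subrr add0r scalerBr.
Qed.

End ExtMore.

Section CoinducedModule.
Variables (R S : comPzRingType) (phi : {rmorphism R -> S}) (p : R -> Prop).
Hypothesis nR : noetherian R.
Variables (D : comPzRingType) (pi : {rmorphism S -> D}).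
Variables (n : nat) (e : 'I_n.+1 -> D) (c : R).
Hypothesis e_free : forall r : 'I_n.+1 -> R,
  \sum_i pi (phi (r i)) * e i = 0 -> forall i, p (r i).

(** M / c^k is the matrix of multiplication by s on D[1/c] in the basis e. *)
Let rel s k (M : 'M[R]_n.+1) :=
  forall i, pi (phi c ^+ k * s) * e i = \sum_j pi (phi (M i j)) * e j.
Hypothesis e_span : forall s, exists k M, rel s k M.

Variable J : lmodType R.
Hypotheses (kJ : killed p J) (cJ : ca J) (rJ : regular c J) (dJ : divisible c J).

Let rJn k := regular_inj (regular_exp (n := k) rJ).

(** Freeness of e determines the fraction M / c^k modulo p, and p kills J. *)
Let rel_unique s k M k' M' (v : 'I_n.+1 -> J) i : rel s k M -> rel s k' M' ->
  c ^+ k' *: mact M v i = c ^+ k *: mact M' v i.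
Proof.
move=> sM sM'; rewrite -!mact_scalar -!mactM; apply: subr0_eq; rewrite -mactBm.
rewrite /mact big1 // => j _; apply: kJ.
apply: (e_free (r := fun j => ((c ^+ k')%:M *m M - (c ^+ k)%:M *m M') i j) _ j).
under eq_bigr => l _ do rewrite !mul_scalar_mx !mxE !rmorphB !rmorphM mulrBl -!mulrA.
rewrite sumrB -!mulr_sumr -sM -sM' !rmorphM !rmorphXn /=; ring.
Qed.

Let act_exists (sv : S * ('I_n.+1 -> J)) : exists w : 'I_n.+1 -> J,
  forall k M, rel sv.1 k M -> forall i, c ^+ k *: w i = mact M sv.2 i.
Proof.
case: sv => s v /=; have [k [M sM]] := e_span s.
have dvd l (x : J) : exists y, x = c ^+ l *: y.
  elim: l => [|l [y ->]]; first by exists x; rewrite expr0 scale1r.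
  by have [z ->] := dJ y; exists z; rewrite scalerA exprSr.
have /choice[w wE] i := dvd k (mact M v i).
exists w => k' M' sM' i; apply: (rJn (k := k)).
by rewrite /= scalerA mulrC -scalerA -wE; apply: rel_unique.
Qed.

(* X = Hom(D[1/c], J) over (R/p)[1/c], realized as J^(n+1) by the values on the basis e. *)
Lemma coinduced_module : exists (X : lmodType S) (i : J -> X) (r : X -> J),
  [/\ ca X, Lin (i : J -> restr phi X), Lin (r : restr phi X -> J) & forall x, r (i x) = x].
Proof.
have [act' actP] := choice act_exists; pose act s v := act' (s, v).
have actE s k M v i : rel s k M -> c ^+ k *: act s v i = mact M v i.
  by move=> sM; apply: (actP (s, v)).
have eq_act k (v w : 'I_n.+1 -> J) : (forall i, c ^+ k *: v i = c ^+ k *: w i) -> v = w.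
  by move=> vw; apply/funext => i; apply: (rJn (k := k)).
have rel_phi r : rel (phi r) 0 r%:M.
  move=> i; rewrite mul1r (bigD1 i) //= mxE eqxx big1 ?addr0 // => j ji.
  by rewrite mxE eq_sym (negPf ji) !rmorph0 mul0r.
have act_phi r v : act (phi r) v = fun i => r *: v i.
  apply/funext => i; have := actE _ _ _ v i (rel_phi r).
  by rewrite expr0 scale1r mact_scalar.
have actA s t v : act s (act t v) = act (s * t) v.
  have [[k [M sM]] [l [N tN]]] := (e_span s, e_span t).
  have stMN : rel (s * t) (k + l) (M *m N).
    move=> i; have -> : phi c ^+ (k + l) * (s * t) = phi c ^+ l * t * (phi c ^+ k * s).
      by rewrite exprD; ring.
    rewrite rmorphM -mulrA sM mulr_sumr; under eq_bigr => j _ do rewrite mulrCA tN mulr_sumr.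
    rewrite exchange_big; apply: eq_bigr => j _.
    rewrite mxE !rmorph_sum mulr_suml; apply: eq_bigr => j' _.
    by rewrite !rmorphM mulrA.
  apply: (@eq_act (k + l)%N) => i; rewrite (actE _ _ _ _ _ stMN) mactM.
  rewrite exprD mulrC -scalerA (actE _ _ _ _ _ sM) -mactZ; congr (mact _ _ _).
  by apply/funext => j; rewrite (actE _ _ _ _ _ tN).
have act1 : left_id 1 act.
  by move=> v; rewrite -(rmorph1 phi) act_phi; apply/funext => i; rewrite scale1r.
have actDr : right_distributive act +%R.
  move=> s v w; have [k [M sM]] := e_span s; apply: (@eq_act k) => i.
  rewrite (actE _ _ _ _ _ sM).
  have -> : (act s v + act s w) i = act s v i + act s w i by [].
  by rewrite scalerDr !(actE _ _ _ _ _ sM) -mactD.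
have actDl v : {morph act^~ v : s t / s + t}.
  move=> s t; have [[k [M sM]] [l [N tN]]] := (e_span s, e_span t).
  have stMN : rel (s + t) (k + l) (c ^+ l *: M + c ^+ k *: N).
    move=> i; have -> : phi c ^+ (k + l) * (s + t) =
        phi c ^+ l * (phi c ^+ k * s) + phi c ^+ k * (phi c ^+ l * t) by rewrite exprD; ring.
    have pushM a b : pi (a * b) * e i = pi a * (pi b * e i) by rewrite rmorphM mulrA.
    rewrite rmorphD mulrDl (pushM _ (phi c ^+ k * s)) (pushM _ (phi c ^+ l * t)) sM tN !mulr_sumr
      -big_split.
    apply: eq_bigr => j _.
    by rewrite !mxE !rmorphD !rmorphM !rmorphXn /= mulrDl !mulrA.
  apply: (@eq_act (k + l)%N) => i; rewrite (actE _ _ _ _ _ stMN).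
  have -> : (act s v + act t v) i = act s v i + act t v i by [].
  have -> : mact (c ^+ l *: M + c ^+ k *: N) v i = c ^+ l *: mact M v i + c ^+ k *: mact N v i.
    rewrite /mact !scaler_sumr -big_split; apply: eq_bigr => j _.
    by rewrite !mxE scalerDl !scalerA.
  rewrite scalerDr -(actE _ _ _ _ _ sM) -(actE _ _ _ _ _ tN) !scalerA exprD.
  by rewrite [c ^+ l * _]mulrC.
pose X := @mk_lmod S ('I_n.+1 -> J) act actA act1 actDr actDl.
exists X, (fun x i => if i == ord0 then x else 0), (fun v => v ord0); split=> //.
(* As s acts by M / c^k, the substitution x_l = c^(k l) y_l absorbs the denominator and leaves a
   system along M in J with right-hand side c^(-k l) ev_l. *)
- move=> s ev; have [k [M sM]] := e_span s.
  have dvd l (x : J) : exists y, c ^+ l *: y = x.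
    elim: l => [|l [y <-]]; first by exists x; rewrite expr0 scale1r.
    by have [z ->] := dJ y; exists z; rewrite scalerA exprSr.
  have /choice[w wE] (li : nat * 'I_n.+1) : exists w, c ^+ (k * li.1) *: w = ev li.1 li.2 by
    apply: dvd.
  have [y yE] := ca_matrix_ca M nR cJ (fun l i => w (l, i)).
  exists (fun l i => c ^+ (k * l) *: y l i) => l; apply/funext => i.
  change (c ^+ (k * l) *: y l i = ev l i + act s (fun i => c ^+ (k * l.+1) *: y l.+1 i) i).
  rewrite yE scalerDr (wE (l, i)); congr (_ + _); apply: (rJn (k := k)).
  by rewrite /= (actE _ _ _ _ _ sM) mactZ scalerA -exprD mulnS.
- move=> r x y; pose g (x : J) (i : 'I_n.+1) := if i == ord0 then x else 0.
  change (g (r *: x + y) = (fun i => act (phi r) (g x) i + g y i)).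
  rewrite act_phi; apply/funext => i.
  by rewrite /g; case: ifP => _ //; rewrite scaler0 addr0.
- move=> r x y.
  change (act (phi r) x ord0 + y ord0 = r *: x ord0 + y ord0).
  by rewrite act_phi.
Qed.

End CoinducedModule.

Section Descent.
Variables (R S : comPzRingType) (phi : {rmorphism R -> S}).
Hypotheses (nR : noetherian R) (fgS : fin_gen_algebra phi) (sphi : spec_surjective phi).

Lemma good_Ext1_generic (p : R -> Prop) : is_prime_ideal p -> exists c, ~ p c /\ forall J, killed
  p J -> ca J -> regular c J -> divisible c J ->
  forall F, good phi F -> Ext1_vanishes F J.
Proof.
move=> pP; have [q [qP qE star]] := maximal_prime_over pP (sphi pP).
have [A [rho [rhoS rhoE]]] := prime_quotient pP.
have [D [pi [piS piE]]] := prime_quotient qP.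
have [lf lfK] := choice rhoS.
have rho_pi r r' : rho r = rho r' -> pi (phi r) = pi (phi r').
  move=> e; apply: subr0_eq; rewrite -!rmorphB; apply/piE/qE/rhoE.
  by rewrite rmorphB e subrr.
(* The induced map R/p -> S/q, computed on chosen lifts; it is injective because q contracts exactly
   to p. *)
pose f0 a := pi (phi (lf a)).
have f0rho r : f0 (rho r) = pi (phi r) by apply: rho_pi; rewrite lfK.
have f0_add : zmod_morphism f0.
  move=> a b; rewrite -[a]lfK -[b]lfK -rmorphB !f0rho.
  by rewrite !rmorphB.
have f0_mul : monoid_morphism f0.
  split=> [|a b]; first by rewrite -(rmorph1 rho) f0rho !rmorph1.
  by rewrite -[a]lfK -[b]lfK -rmorphM !f0rho !rmorphM.
pose f : {rmorphism A -> D} := HB.pack f0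
  (GRing.isZmodMorphism.Build _ _ f0 f0_add) (GRing.isMonoidMorphism.Build _ _ f0 f0_mul).
have frho r : f (rho r) = pi (phi r) by apply: f0rho.
have fI : injective f.
  move=> a b; rewrite -[a]lfK -[b]lfK !frho => e; apply: subr0_eq; rewrite -rmorphB.
  by apply/rhoE/qE/piE; rewrite !rmorphB e subrr.
case: fgS => gens gensP; pose xs := [seq pi g | g <- gens].
have gen y : generated f xs y.
  move=> P P1 P2 P3 P4; have [s <-] := piS y; apply: (gensP s (fun s => P (pi s))).
  - by move=> r; rewrite -frho.
  - by move=> g gg; apply/P2/map_f.
  - by move=> u v; rewrite rmorphD; apply: P3.
  - by move=> u v; rewrite rmorphM; apply: P4.
have inv y : y <> 0 -> exists t u, u <> 0 /\ y * t = f u.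
  have [s <-] := piS y => s0; have [|t [u [npu su]]] := star s; first by move=> /piE.
  exists (pi t), (rho u); split; first by move=> /rhoE.
  by rewrite frho; apply: subr0_eq; rewrite -rmorphM -rmorphB; apply/piE.
have alg x : x \in xs -> algebraic f x.
  by apply: (@zariski_lemma _ xs A f [::] fI inv) => //; rewrite cats0.
have [n [e [c [c0 free span]]]] := generic_basis fI gen alg.
exists (lf c); split=> [/rhoE|J kJ cJ rJ dJ F gF]; first by rewrite lfK; apply/eqP.
have [||X [i [r [cX iL rL ri]]]] := @coinduced_module R S phi p nR D pi n e (lf c) _ _ J kJ cJ rJ
  dJ.
- move=> r r0 i; apply/rhoE; apply: (free (fun i => rho (r i))).
  by rewrite -[RHS]r0; apply: eq_bigr => j _; rewrite frho.
- move=> s; have [k [M ME]] := span (pi s); exists k, (map_mx lf M) => i.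
  rewrite rmorphM rmorphXn -frho lfK ME; apply: eq_bigr => j _.
  by rewrite mxE -frho lfK.
by apply: (Ext1_retract iL rL ri); apply: good_Ext1.
Qed.

Lemma good_very_flat F : good phi F -> very_flat F.
Proof.
move=> gF C /contraadjustedP cC.
(* F is quantified inside the induction, since the step from K and P to C applies the claim for K to
   a syzygy of F. *)
suff H : forall C, ca C -> forall F, good phi F -> Ext1_vanishes F C by apply: H.
apply: (@devissage R (fun C => forall F, good phi F -> Ext1_vanishes F C)) => //.
- by move=> D D0 G _; apply: Ext1_zero.
- by move=> D E L f g fg VD VL G gG; apply: (Ext1_extension fg); [apply: VD | apply: VL].
- by move=> c D D' g gL gS gE rD sep cD V G gG; apply: (Ext1_complete gL gS gE) => //; apply: V.
- move=> K P D f g fg VK VP G gG; have [G' [K' [k [p [Gp kp gK]]]]] := good_presentation gG.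
  by apply: (Ext1_quotient Gp kp fg); [apply: VK | apply: VP].
- exact: good_Ext1_generic.
Qed.
End Descent.

Theorem theorem1p10 (R S : comPzRingType) (phi : {rmorphism R -> S})
  (F : lmodType R) :
  noetherian R -> fin_gen_algebra phi -> spec_surjective phi -> flat F ->
  forall (T : lmodType S) (j : F -> T), IsBaseChange phi j ->
    (very_flat F <-> very_flat T).
Proof.
move=> nR fgS sphi fF T j bT; split; first exact: very_flat_base_change bT.
move=> vT; apply: (good_very_flat nR fgS sphi); split; first exact: flat_eq_flat.
by exists T, j.
Qed.
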